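(* When the number $K\ge 1$ of terminals is fixed, ML-CAP-STEINER-TREE (resp. CAP-STEINER-TREE) with uniform capacity (all $c(e)$, $e\in E$, equal) is polynomially reducible to ML-VDISJ-PATH (resp. VDISJ-PATH) with a fixed number of source-sink pairs. (This holds for undirected graphs, and likewise for directed graphs.)
   Context: Graphs $G=(V,E)$ are finite and may be directed or undirected; ''path'' means directed path in the directed case. ML-CAP-STEINER-TREE. Input: a connected graph $G=(V,E)$; a set $T\subset V$ of $K\ge 1$ terminals; a root $r\in V\setminus T$ (if $G$ is directed, there is a directed path from $r$ to every vertex of $V$); a nonnegative rational length $\ell(e)$ and a positive integer capacity $c(e)$ for every $e\in E$. Objective: determine, if one exists, a tree $S$ in $G$, directed away from its root $r$, that spans all vertices of $T$ (it need not span $V$), satisfies the capacity constraints, and has minimum total length. The capacity constraints say: for every arc $e=(u,v)$ of $S$, the subtree of $S$ rooted at $v$ contains at most $c(e)$ terminals. If $G$ is undirected, an arc $(u,v)$ of $S$ must be such that $[u,v]\in E$, and it has the length and capacity of that edge. CAP-STEINER-TREE is the special case in which all lengths are $0$, i.e. the decision problem asking whether a tree rooted at $r$, spanning $T$ and satisfying the capacity constraints exists. ML-VDISJ-PATH. Input: a graph $G=(V,E)$; a nonnegative length function $\ell$ on $E$; $p$ disjoint vertex pairs (source-sink pairs) $(s_1,s'_1),\dots,(s_p,s'_p)$. Objective: find, if they exist, $p$ mutually vertex-disjoint paths $\mu_1,\dots,\mu_p$ of minimum total length such that $\mu_i$ links $s_i$ to $s'_i$ for $i=1,\dots,p$. VDISJ-PATH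 is the special case in which all lengths are $0$, i.e. the decision problem asking whether such disjoint paths exist. ''Fixed number of source-sink pairs'' means a number of pairs bounded by a constant depending only on $K$. ''Polynomially reducible'' here means: an instance of the first problem can be solved in polynomial time given an oracle that solves instances of the second problem (so polynomially many instances of the second problem, on graphs of the same type, may be solved). *)

(* Defs.v *)
From HB Require Import structures.
From mathcomp Require Import all_boot all_order all_algebra.
From mathcomp Require Import boolp.

Set Implicit Arguments.
Unset Strict Implicit.
Unset Printing Implicit Defensive.

Import Order.TTheory GRing.Theory Num.Theory.

(* -------------------------------------------------------------------------- *)
(* Polynomial-time oracle computation.                                        *)
(* Data are S-expressions over natural numbers.  Programs are while-programs  *)
(* in point-free form: a program transforms one datum, its whole memory.      *)
(* Costs are logarithmic (numbers are measured by their bit length) and every *)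
(* step is charged at least the sizes of the data it reads and writes, so     *)
(* that polynomial time here is polynomial time on oracle Turing machines.    *)
(* -------------------------------------------------------------------------- *)

Inductive value := VNat of nat | VPair of value & value.

Fixpoint value_eqb (x y : value) : bool :=
  match x, y with
  | VNat m, VNat n => m == n
  | VPair a b, VPair c d => value_eqb a c && value_eqb b d
  | _, _ => false
  end.

Lemma value_eqP : Equality.axiom value_eqb.
Proof.
elim=> [m|a IHa b IHb] [n|c d] /=; try by constructor.
  by apply: (iffP eqP) => [->|[]].
apply: (iffP andP) => [[/IHa-> /IHb->] //|[<- <-]].
by split; [apply/IHa | apply/IHb].
Qed.

HB.instance Definition _ := hasDecEq.Build value value_eqP.

Fixpoint vsize (x : value) : nat :=
  match x with
  | VNat n => (trunc_log 2 n).+1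
  | VPair a b => (vsize a + vsize b).+1
  end.

Definition as_nat (x : value) : nat := if x is VNat n then n else 0.
Definition vfst (x : value) : value := if x is VPair a _ then a else VNat 0.
Definition vsnd (x : value) : value := if x is VPair _ b then b else VNat 0.
Definition vbool (b : bool) : value := VNat b.

Inductive prim := PId | PFst | PSnd | PAdd | PSub | PMul | PLeq | PEq.

Definition prim_eval (o : prim) (x : value) : value :=
  let m := as_nat (vfst x) in let n := as_nat (vsnd x) in
  match o with
  | PId => x
  | PFst => vfst x
  | PSnd => vsnd x
  | PAdd => VNat (m + n)
  | PSub => VNat (m - n)
  | PMul => VNat (m * n)
  | PLeq => vbool (m <= n)
  | PEq => vbool (vfst x == vsnd x)
  end.

Inductive prog :=
| Prim of prim
| Const of value
| Query
| Seq of prog & prog           (* first, then second *)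
| Fork of prog & prog          (* both on the same input, results paired *)
| If of prog & prog & prog
| While of prog & prog.

(* [exec ok O f x y t]: with oracle O, f run on x halts with result y at cost *)
(* t.  A query outside [ok] blocks the execution.                             *)
Inductive exec (ok : value -> Prop) (O : value -> value) :
    prog -> value -> value -> nat -> Prop :=
| exec_prim o x :
    exec ok O (Prim o) x (prim_eval o x) (vsize x + vsize (prim_eval o x))
| exec_const c x :
    exec ok O (Const c) x c (vsize x + vsize c)
| exec_query x :
    ok x -> exec ok O Query x (O x) (vsize x + vsize (O x))
| exec_seq f g x y z m n :
    exec ok O f x y m -> exec ok O g y z n -> exec ok O (Seq f g) x z (m + n)
| exec_fork f g x y z m n :
    exec ok O f x y m -> exec ok O g x z n ->
    exec ok O (Fork f g) x (VPair y z) (vsize x + m + n + vsize (VPair y z))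
| exec_if_true b f g x v y m n :
    exec ok O b x v m -> v != vbool false -> exec ok O f x y n ->
    exec ok O (If b f g) x y (vsize x + m + n)
| exec_if_false b f g x y m n :
    exec ok O b x (vbool false) m -> exec ok O g x y n ->
    exec ok O (If b f g) x y (vsize x + m + n)
| exec_while_true b f x v y z m n k :
    exec ok O b x v m -> v != vbool false -> exec ok O f x y n ->
    exec ok O (While b f) y z k ->
    exec ok O (While b f) x z (vsize x + m + n + k)
| exec_while_false b f x m :
    exec ok O b x (vbool false) m ->
    exec ok O (While b f) x x (vsize x + m).

(* [correct I y]: y codes an acceptable answer to the instance I.             *)
Record problem := Problem {
  instance : Type;
  valid : instance -> Prop;
  code : instance -> value;
  correct : instance -> value -> Prop }.

Definition restrict (P : problem) (R : instance P -> Prop) : problem :=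
  @Problem (instance P) (fun I => valid I /\ R I) (@code P) (@correct P).

Definition solves (P : problem) (O : value -> value) : Prop :=
  forall I : instance P, valid I -> correct I (O (code I)).

Definition is_instance (P : problem) (x : value) : Prop :=
  exists2 I : instance P, valid I & x = code I.

Definition poly_reducible (P Q : problem) : Prop :=
  exists (f : prog) (c d : nat),
    forall O : value -> value, solves Q O ->
    forall I : instance P, valid I ->
    exists (y : value) (t : nat),
      [/\ exec (is_instance Q) O f (code I) y t,
          correct I y &
          t <= c * vsize (code I) ^ d].

(* -------------------------------------------------------------------------- *)
(* Coding of data and of answers                                              *)
(* -------------------------------------------------------------------------- *)

Definition code_seq (T : Type) (enc : T -> value) (s : seq T) : value :=
  foldr (fun x v => VPair (enc x) v) (VNat 0) s.

(* Used for nonnegative rationals only, on which it is injective.             *)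
Definition code_rat (q : rat) : value :=
  VPair (VNat `|numq q|%N) (VNat `|denq q|%N).

Definition code_none : value := VNat 0.
Definition code_some (v : value) : value := VPair v (VNat 0).

Definition decision_answer (S : Type) (feasible : S -> Prop) (y : value) :=
  y = vbool `[< exists s, feasible s >].

Definition optimal_answer (S : Type) (feasible : S -> Prop) (cost : S -> rat)
    (enc : S -> value) (y : value) : Prop :=
  (exists s, [/\ feasible s,
                 forall s', feasible s' -> (cost s <= cost s')%R &
                 y = code_some (enc s)])
  \/ ((forall s, ~ feasible s) /\ y = code_none).

(* -------------------------------------------------------------------------- *)
(* Graphs                                                                     *)
(* -------------------------------------------------------------------------- *)

Definition arc : Type := nat * nat.

Inductive orientation := Directed | Undirected.

(* An undirected graph is given by both orientations of each of its edges.    *)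
Record graph := Graph { verts : seq nat; arcs : seq arc }.

Definition arev (e : arc) : arc := (e.2, e.1).

Definition wf_graph (o : orientation) (G : graph) : Prop :=
  [/\ uniq (verts G), uniq (arcs G),
      forall e, e \in arcs G ->
        [/\ e.1 \in verts G, e.2 \in verts G & e.1 != e.2] &
      o = Undirected -> forall e, e \in arcs G -> arev e \in arcs G].

(* Edge data of an undirected graph do not depend on the orientation.         *)
Definition wf_weight (T : Type) (o : orientation) (G : graph) (w : arc -> T) :=
  o = Undirected -> forall e, e \in arcs G -> w (arev e) = w e.

Definition adj (A : seq arc) : rel nat := [rel u v | (u, v) \in A].

Definition reach (A : seq arc) (u v : nat) : Prop :=
  exists2 p, path (adj A) u p & last u p = v.

Definition connected (G : graph) : Prop :=
  forall u v, u \in verts G -> v \in verts G ->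
    reach (arcs G ++ map arev (arcs G)) u v.

Definition code_graph (G : graph) (data : arc -> value) : value :=
  VPair (code_seq VNat (verts G))
        (code_seq (fun e => VPair (VPair (VNat e.1) (VNat e.2)) (data e))
                  (arcs G)).

(* -------------------------------------------------------------------------- *)
(* Capacitated Steiner trees                                                  *)
(* -------------------------------------------------------------------------- *)

Record steiner := Steiner {
  st_graph : graph;
  st_terms : seq nat;
  st_root : nat;
  st_len : arc -> rat;
  st_cap : arc -> nat }.

Definition steiner_valid (o : orientation) (I : steiner) : Prop :=
  let G := st_graph I in let T := st_terms I in let r := st_root I in
  [/\ wf_graph o G /\ connected G,
      [/\ uniq T, {subset T <= verts G} & 0 < size T],
      r \in verts G /\ r \notin T,
      o = Directed -> forall v, v \in verts G -> reach (arcs G) r v &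
      [/\ wf_weight o G (st_len I), wf_weight o G (st_cap I) &
          forall e, e \in arcs G -> (0 <= st_len I e)%R /\ 0 < st_cap I e]].

Definition steiner_code (I : steiner) : value :=
  VPair (code_graph (st_graph I)
           (fun e => VPair (code_rat (st_len I e)) (VNat (st_cap I e))))
        (VPair (code_seq VNat (st_terms I)) (VNat (st_root I))).

(* A tree directed away from r is given by its arcs, r being always one of    *)
(* its vertices; from r there is exactly one directed walk to each vertex.    *)
Definition tree_verts (r : nat) (A : seq arc) : seq nat :=
  r :: map fst A ++ map snd A.

Definition tree_from (r : nat) (A : seq arc) : Prop :=
  uniq A /\
  forall v, v \in tree_verts r A ->
    exists! p, path (adj A) r p /\ last r p = v.

Definition subtree_terms (T : seq nat) (A : seq arc) (v : nat) : nat :=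
  count (fun t => `[< reach A v t >]) T.

Definition steiner_feasible (I : steiner) (A : seq arc) : Prop :=
  [/\ {subset A <= arcs (st_graph I)},
      tree_from (st_root I) A,
      {subset st_terms I <= tree_verts (st_root I) A} &
      forall e, e \in A -> subtree_terms (st_terms I) A e.2 <= st_cap I e].

Definition steiner_cost (I : steiner) (A : seq arc) : rat :=
  (\sum_(e <- A) st_len I e)%R.

Definition code_arcs : seq arc -> value :=
  code_seq (fun e : arc => VPair (VNat e.1) (VNat e.2)).

Definition ML_CAP_STEINER_TREE (o : orientation) : problem :=
  @Problem steiner (steiner_valid o) steiner_code
    (fun I => optimal_answer (steiner_feasible I) (steiner_cost I) code_arcs).

Definition CAP_STEINER_TREE (o : orientation) : problem :=
  @Problem steiner
    (fun I => steiner_valid o I /\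
              forall e, e \in arcs (st_graph I) -> st_len I e = 0%R)
    steiner_code
    (fun I => decision_answer (steiner_feasible I)).

Definition uniform_cap (I : steiner) : Prop :=
  forall e e', e \in arcs (st_graph I) -> e' \in arcs (st_graph I) ->
    st_cap I e = st_cap I e'.

(* -------------------------------------------------------------------------- *)
(* Vertex-disjoint paths                                                      *)
(* -------------------------------------------------------------------------- *)

Record vdisj := VDisj {
  vd_graph : graph;
  vd_len : arc -> rat;
  vd_pairs : seq (nat * nat) }.

Definition vdisj_valid (o : orientation) (I : vdisj) : Prop :=
  let G := vd_graph I in let ends := map fst (vd_pairs I) ++ map snd (vd_pairs I) in
  [/\ wf_graph o G,
      wf_weight o G (vd_len I),
      forall e, e \in arcs G -> (0 <= vd_len I e)%R &
      uniq ends /\ {subset ends <= verts G}].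

Definition vdisj_code (I : vdisj) : value :=
  VPair (code_graph (vd_graph I) (fun e => code_rat (vd_len I e)))
        (code_arcs (vd_pairs I)).

(* A path is given by the sequence of its vertices, both ends included.       *)
Definition links (G : graph) (st : nat * nat) (mu : seq nat) : bool :=
  if mu is x :: p then
    [&& x == st.1, path (adj (arcs G)) x p, last x p == st.2 & uniq mu]
  else false.

Definition vdisj_feasible (I : vdisj) (mus : seq (seq nat)) : Prop :=
  all2 (links (vd_graph I)) (vd_pairs I) mus /\
  pairwise (fun mu nu => ~~ has (mem mu) nu) mus.

Definition path_arcs (mu : seq nat) : seq arc := zip mu (behead mu).

Definition vdisj_cost (I : vdisj) (mus : seq (seq nat)) : rat :=
  (\sum_(mu <- mus) \sum_(e <- path_arcs mu) vd_len I e)%R.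

Definition ML_VDISJ_PATH (o : orientation) : problem :=
  @Problem vdisj (vdisj_valid o) vdisj_code
    (fun I => optimal_answer (vdisj_feasible I) (vdisj_cost I)
                (code_seq (code_seq VNat))).

Definition VDISJ_PATH (o : orientation) : problem :=
  @Problem vdisj
    (fun I => vdisj_valid o I /\
              forall e, e \in arcs (vd_graph I) -> vd_len I e = 0%R)
    vdisj_code
    (fun I => decision_answer (vdisj_feasible I)).

(* Main.v *)
(* In a minimal solution the root, the terminals and the branching vertices cut *)
(* the tree into at most 2K paths which are disjoint but for their ends.  The   *)
(* "skeleton" obtained by contracting each path to one arc has bounded size, so *)
(* all skeletons on the vertices of G can be enumerated in polynomial time, and *)
(* since the capacity is uniform, whether the capacity constraints hold depends *)
(* only on the skeleton.  For a given skeleton, replacing each of its vertices  *)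
(* by one copy per incident arc turns the search for the paths into an instance *)
(* of disjoint paths, with one source-sink pair for each arc of the skeleton.   *)
(* The cheapest of the trees so obtained is optimal.                            *)
(*                                                                              *)
(* Existence of a small skeleton: attach the terminals one after the other, by  *)
(* the part of their path from the root which lies outside the tree built so    *)
(* far.  Each new terminal creates at most one new path, and splits at most one *)
(* old path.                                                                    *)

From mathcomp Require Import all_boot all_order all_algebra.
From mathcomp Require Import boolp zify.
Require Import Defs.

Set Implicit Arguments.
Unset Strict Implicit.
Unset Printing Implicit Defensive.

Import Order.TTheory GRing.Theory Num.Theory.

(** * Sizes of values and polynomial bounds *)

(** Let the terminals be attached one by one to the root along the walks of a feasible tree. This
    produces a path system with at most [2 * K] paths ([psys_exists]). A walk that starts inside one
    of its paths can leave it only at its end, so the terminals below any arc of a path are among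
    the descendants of that end in the skeleton ([psys_descendants]). With equal capacities, the
    constraints can therefore be tested on the skeleton alone ([skeleton_ok]).

    For a fixed skeleton [q], the paths share only ends, and the split graph makes them fully
    disjoint: the path of the arc [(u, v)] runs from [copy u v] through diagonal copies to
    [copy v v]. Diagonal copies express that each vertex is entered once. The off-diagonal ones let
    several paths start at the same vertex. The diagonal copy of the root is isolated, so no path
    returns there. By [embed_feasible] and [feasible_embed], path systems with skeleton [q] and
    solutions of the split instance correspond, and by [split_cost] their costs agree.

    Consequently each answer for an admissible skeleton merges into a feasible tree of the same cost
    ([split_sound]), and each feasible tree is matched by a solution, for some admissible skeleton,
    that costs no more ([split_complete]). The cheapest merged answer is then optimal; in the
    decision version, a tree exists exactly when some query is answered positively.

    For the running time, [polytime] is closed under the usual list operations, the crucial one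
    being the bounded iteration [poly_foldl]. As [K] is constant, the lists of at most [2 * K]
    vertex pairs can be enumerated ([poly_candidates]), and [poly_reducible_by_queries] turns such
    an enumeration of queries into an oracle program. *)

Lemma vsize_gt0 x : 0 < vsize x.
Proof. by case: x. Qed.

Lemma vsize_nat_lt n k : 0 < k -> n < 2 ^ k -> vsize (VNat n) <= k.
Proof.
case: n => [|n] k0 nk; first by rewrite /= trunc_log0.
by rewrite /= -(ltn_exp2l _ _ (isT : 1 < 2)) (leq_ltn_trans (trunc_logP _ _) nk).
Qed.

Lemma vsize_nat_gt n : n < 2 ^ vsize (VNat n).
Proof. exact: trunc_log_ltn. Qed.

Lemma vsize_nat_le m n : m <= n -> vsize (VNat m) <= vsize (VNat n).
Proof. by move=> mn; rewrite /= ltnS leq_trunc_log. Qed.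

Lemma vsize_add m n : vsize (VNat (m + n)) <= vsize (VNat m) + vsize (VNat n).
Proof.
apply: vsize_nat_lt; first by rewrite addn_gt0 vsize_gt0.
have m2 := vsize_nat_gt m; have n2 := vsize_nat_gt n.
rewrite expnD; apply: leq_ltn_trans (_ : _ <= m.+1 * n.+1 - 1) _; first by nia.
by rewrite -subSn ?muln_gt0 // subn1 leq_mul.
Qed.

Lemma vsize_mul m n : vsize (VNat (m * n)) <= vsize (VNat m) + vsize (VNat n).
Proof.
apply: vsize_nat_lt; first by rewrite addn_gt0 vsize_gt0.
by rewrite expnD ltn_mul ?vsize_nat_gt.
Qed.

Lemma vsize_fst x : vsize (vfst x) <= vsize x.
Proof. by case: x => //= a b; rewrite leqW ?leq_addr. Qed.

Lemma vsize_snd x : vsize (vsnd x) <= vsize x.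
Proof. by case: x => //= a b; rewrite leqW ?leq_addl. Qed.

Lemma vsize_as_nat x : vsize (VNat (as_nat x)) <= vsize x.
Proof. by case: x => // a b; rewrite vsize_gt0. Qed.

Lemma vsize_as_nat_pair x :
  vsize (VNat (as_nat (vfst x))) + vsize (VNat (as_nat (vsnd x))) <= (vsize x).+1.
Proof.
by case: x => [n|a b] //=; rewrite !leqW // leq_add // vsize_as_nat.
Qed.

Lemma vsize_bool (b : bool) : vsize (vbool b) = 1.
Proof. by case: b. Qed.

Lemma vsize_prim o x : vsize (prim_eval o x) <= (vsize x).+1.
Proof.
case: o => /=; rewrite ?leqnSn //.
- exact: leqW (vsize_fst x).
- exact: leqW (vsize_snd x).
- exact: leq_trans (vsize_add _ _) (vsize_as_nat_pair x).
- apply: leq_trans (vsize_as_nat_pair x).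
  exact: leq_trans (vsize_nat_le (leq_subr _ _)) (leq_addr _ _).
- exact: leq_trans (vsize_mul _ _) (vsize_as_nat_pair x).
- by rewrite -[(trunc_log _ _).+1]/(vsize (vbool _)) vsize_bool.
- by rewrite -[(trunc_log _ _).+1]/(vsize (vbool _)) vsize_bool.
Qed.

(** Every rule charges for what is read and written, so a bound on the cost also bounds the result.
    This is what makes polynomial bounds compose. *)
Lemma exec_size ok O f x y t :
  exec ok O f x y t -> vsize x <= t /\ vsize y <= t.
Proof. by elim=> *; lia. Qed.

Definition pbound (X : Type) (D : X -> Prop) (i : X -> value) (b : X -> nat) :=
  exists c d, forall x, D x -> b x <= c * vsize (i x) ^ d.

Section PolynomialBounds.
Variables (X : Type) (D : X -> Prop) (i : X -> value).

Lemma pbound_le b b' :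
  (forall x, D x -> b x <= b' x) -> pbound D i b' -> pbound D i b.
Proof.
move=> bb' [c [d h]]; exists c, d => x Dx.
exact: leq_trans (bb' x Dx) (h x Dx).
Qed.

Lemma pbound_const k : pbound D i (fun=> k).
Proof. by exists k, 0 => x _; rewrite muln1. Qed.

Lemma pbound_size : pbound D i (fun x => vsize (i x)).
Proof. by exists 1, 1 => x _; rewrite mul1n. Qed.

Lemma pbound_add b b' :
  pbound D i b -> pbound D i b' -> pbound D i (fun x => b x + b' x).
Proof.
move=> [c [d h]] [c' [d' h']]; exists (c + c'), (d + d') => x Dx.
apply: leq_trans (leq_add (h x Dx) (h' x Dx)) _.
rewrite mulnDl expnD leq_add // leq_mul //.
  by rewrite leq_pmulr // expn_gt0 vsize_gt0.
by rewrite leq_pmull // expn_gt0 vsize_gt0.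
Qed.

Lemma pbound_mul b b' :
  pbound D i b -> pbound D i b' -> pbound D i (fun x => b x * b' x).
Proof.
move=> [c [d h]] [c' [d' h']]; exists (c * c'), (d + d') => x Dx.
by rewrite expnD mulnACA leq_mul ?h ?h'.
Qed.

Lemma pbound_comp m b :
  pbound D i (fun x => vsize (m x)) -> pbound D m b -> pbound D i b.
Proof.
move=> [c [d h]] [c' [d' h']]; exists (c' * c ^ d'), (d * d') => x Dx.
apply: leq_trans (h' x Dx) _.
rewrite -mulnA leq_mul2l; apply/orP; right.
by rewrite expnM -expnMn; case: (posnP d') => [->//|d0]; rewrite leq_exp2r // h.
Qed.

End PolynomialBounds.

(** * Polynomial-time execution *)

(* An execution context: the admissible queries and the oracle. *)
Definition context : Type := (value -> Prop) * (value -> value).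

(** The program and the constants are chosen before [x], whereas the context depends on [x]: one
    program serves all oracles. *)
Definition run (X : Type) (K : X -> context) (D : X -> Prop) (i o : X -> value) :=
  exists f c d, forall x, D x ->
    exists2 t, exec (K x).1 (K x).2 f (i x) (o x) t & t <= c * vsize (i x) ^ d.

Lemma runI (X : Type) (K : X -> context) (D : X -> Prop) (i o : X -> value)
    (f : prog) (b : X -> nat) :
  pbound D i b ->
  (forall x, D x -> exists2 t, exec (K x).1 (K x).2 f (i x) (o x) t & t <= b x) ->
  run K D i o.
Proof.
move=> [c [d h]] hf; exists f, c, d => x Dx.
by have [t ft tb] := hf x Dx; exists t => //; apply: leq_trans tb (h x Dx).
Qed.

Section Run.
Variables (X : Type) (K : X -> context) (D : X -> Prop).
Implicit Types i o m : X -> value.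

Lemma run_sub (D' : X -> Prop) i o :
  (forall x, D' x -> D x) -> run K D i o -> run K D' i o.
Proof. by move=> D'D [f [c [d H]]]; exists f, c, d => x /D'D; apply: H. Qed.

Lemma run_ext i o i' o' :
  (forall x, D x -> i x = i' x) -> (forall x, D x -> o x = o' x) ->
  run K D i o -> run K D i' o'.
Proof.
move=> eqi eqo [f [c [d H]]]; exists f, c, d => x Dx.
by rewrite -eqi // -eqo //; apply: H.
Qed.

Lemma run_size i o : run K D i o -> pbound D i (fun x => vsize (o x)).
Proof.
move=> [f [c [d H]]]; exists c, d => x Dx; have [t ft tb] := H x Dx.
by apply: leq_trans tb; case: (exec_size ft).
Qed.

Lemma run_prim a i : run K D i (fun x => prim_eval a (i x)).
Proof.
apply: (@runI _ _ _ _ _ (Prim a) (fun x => vsize (i x) + (vsize (i x) + 1))).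
  by apply: pbound_add (pbound_add _ (pbound_const _ _ 1)); apply: pbound_size.
move=> x Dx; eexists; first exact: exec_prim.
by rewrite leq_add2l addn1 vsize_prim.
Qed.

Lemma run_id i : run K D i i.
Proof. exact: run_prim PId i. Qed.

Lemma run_const i v : run K D i (fun=> v).
Proof.
apply: (@runI _ _ _ _ _ (Const v) (fun x => vsize (i x) + vsize v)).
  by apply: pbound_add; [apply: pbound_size | apply: pbound_const].
by move=> x Dx; eexists; first exact: exec_const.
Qed.

Lemma run_query i :
  (forall x, D x -> (K x).1 (i x)) ->
  pbound D i (fun x => vsize ((K x).2 (i x))) ->
  run K D i (fun x => (K x).2 (i x)).
Proof.
move=> ok bO.
apply: (@runI _ _ _ _ _ Query (fun x => vsize (i x) + vsize ((K x).2 (i x)))).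
  by apply: pbound_add bO; apply: pbound_size.
by move=> x Dx; eexists; first by apply: exec_query; apply: ok.
Qed.

(** The intermediate value has polynomial size by [run_size], so the cost of the second program is a
    polynomial of a polynomial. *)
Lemma run_seq m i o : run K D i m -> run K D m o -> run K D i o.
Proof.
move=> im mo; have ms := run_size im.
case: im => f [c [d H]]; case: mo => g [c' [d' H']].
apply: (@runI _ _ _ _ _ (Seq f g)
         (fun x => c * vsize (i x) ^ d + c' * vsize (m x) ^ d')).
  apply: pbound_add; first by exists c, d.
  by apply: pbound_comp ms _; exists c', d'.
move=> x Dx; have [t ft tb] := H x Dx; have [t' ft' tb'] := H' x Dx.
by exists (t + t'); [apply: exec_seq ft ft' | apply: leq_add].
Qed.

Lemma run_fork i o o' :
  run K D i o -> run K D i o' -> run K D i (fun x => VPair (o x) (o' x)).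
Proof.
move=> io io'; have os := run_size io; have os' := run_size io'.
case: io => f [c [d H]]; case: io' => g [c' [d' H']].
apply: (@runI _ _ _ _ _ (Fork f g) (fun x =>
  vsize (i x) + c * vsize (i x) ^ d + c' * vsize (i x) ^ d' +
  (vsize (o x) + vsize (o' x) + 1))).
  do !apply: pbound_add => //; try exact: pbound_const; try exact: pbound_size.
    by exists c, d.
  by exists c', d'.
move=> x Dx; have [t ft tb] := H x Dx; have [t' ft' tb'] := H' x Dx.
eexists; first exact: exec_fork ft ft'.
by rewrite /= addn1 leq_add2r -!addnA leq_add2l leq_add.
Qed.

Lemma run_fst i a b : run K D i (fun x => VPair (a x) (b x)) -> run K D i a.
Proof. by move=> h; apply: run_seq h _; apply: run_prim PFst _. Qed.

Lemma run_snd i a b : run K D i (fun x => VPair (a x) (b x)) -> run K D i b.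
Proof. by move=> h; apply: run_seq h _; apply: run_prim PSnd _. Qed.

End Run.

Lemma run_if (X : Type) (K : X -> context) D (b : X -> bool) i o o' :
  run K D i (fun x => vbool (b x)) ->
  run K (fun x => D x /\ b x) i o -> run K (fun x => D x /\ ~~ b x) i o' ->
  run K D i (fun x => if b x then o x else o' x).
Proof.
move=> [h [c0 [d0 H0]]] [f [c [d H]]] [g [c' [d' H']]].
apply: (@runI _ _ _ _ _ (If h f g) (fun x => vsize (i x) +
   c0 * vsize (i x) ^ d0 + (c * vsize (i x) ^ d + c' * vsize (i x) ^ d'))).
  by do !apply: pbound_add; first (exact: pbound_size);
    [exists c0, d0 | exists c, d | exists c', d'].
move=> x Dx; have [t0 ft0 tb0] := H0 x Dx; case bx: (b x) in ft0 *.
  have [//|t ft tb] := H x; eexists; first exact: exec_if_true ft0 _ ft.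
  by rewrite !leq_add // (leq_trans tb) // leq_addr.
have [|t ft tb] := H' x; first by rewrite bx.
eexists; first exact: exec_if_false ft0 ft.
by rewrite !leq_add // (leq_trans tb) // leq_addl.
Qed.

Definition vlist (s : seq value) : value := code_seq id s.

Lemma vsize_vlist_drop n s : vsize (vlist (drop n s)) <= vsize (vlist s).
Proof.
elim: s n => [|x s IHs] [|n] //=; rewrite leqW //.
exact: leq_trans (IHs n) (leq_addl _ _).
Qed.

Lemma size_vlist s : size s < vsize (vlist s).
Proof. by elim: s => //= x s IHs; rewrite ltnS (leq_trans IHs) // leq_addl. Qed.

(** The loop state consists of the accumulator, the remaining list and an environment. The remaining
    list serves as loop test, because the code of [[::]] is [VNat 0], which is also [vbool false].
    The bound [b] covers one call of [f] as well as one state; the factor 40 absorbs the projections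
    that rebuild the state in each round. *)
Lemma exec_fold ok O (f : prog) (l : seq value) (a : nat -> value) env b n :
  (forall i, n <= i < size l -> exists2 t,
     exec ok O f (VPair (a i) (VPair (nth (VNat 0) l i) env)) (a i.+1) t & t <= b) ->
  (forall i, n <= i <= size l ->
     vsize (VPair (a i) (VPair (vlist l) env)) <= b) ->
  n <= size l ->
  exists2 t, exec ok O
    (While (Seq (Prim PSnd) (Prim PFst))
       (Fork (Seq (Fork (Prim PFst)
           (Fork (Seq (Prim PSnd) (Seq (Prim PFst) (Prim PFst)))
                 (Seq (Prim PSnd) (Prim PSnd)))) f)
          (Fork (Seq (Prim PSnd) (Seq (Prim PFst) (Prim PSnd)))
                (Seq (Prim PSnd) (Prim PSnd)))))
    (VPair (a n) (VPair (vlist (drop n l)) env))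
    (VPair (a (size l)) (VPair (vlist [::]) env)) t & t <= (size l - n).+1 * (40 * b).
Proof.
move=> fb sb; elim: {n}(size l - n) {-2}n (erefl (size l - n)) fb sb => [|k IHk] n nl fb sb nsl.
  have -> : n = size l by lia.
  have nb := sb n; rewrite drop_size.
  eexists; first apply: exec_while_false.
    exact: exec_seq (exec_prim _ _ _ _) (exec_prim _ _ _ _).
  have {nb} : vsize (VPair (a (size l)) (VPair (vlist l) env)) <= b.
    by apply: sb; lia.
  have := size_vlist l; rewrite /= trunc_log0; lia.
have nl' : n < size l by lia.
have [t ft tb] : exists2 t, exec ok O f
    (VPair (a n) (VPair (nth (VNat 0) l n) env)) (a n.+1) t & t <= b.
  by apply: fb; rewrite leqnn.
have [||||t' ft' tb'] := IHk n.+1; first lia.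
- by move=> i /andP[ni il]; apply: fb; rewrite (ltnW ni).
- by move=> i /andP[ni il]; apply: sb; rewrite (ltnW ni).
- by [].
have bn : vsize (VPair (a n) (VPair (vlist l) env)) <= b by apply: sb; lia.
have bn' : vsize (VPair (a n.+1) (VPair (vlist l) env)) <= b by apply: sb; lia.
have := vsize_vlist_drop n l; rewrite (drop_nth (VNat 0)) //= => dl.
eexists; first (apply: exec_while_true).
- exact: exec_seq (exec_prim _ _ _ _) (exec_prim _ _ _ _).
- by [].
- apply: exec_fork; first apply: exec_seq ft.
    apply: exec_fork; first exact: exec_prim.
    apply: exec_fork; last exact: exec_seq (exec_prim _ _ _ _) (exec_prim _ _ _ _).
    apply: exec_seq; first exact: exec_prim.
    exact: exec_seq (exec_prim _ _ _ _) (exec_prim _ _ _ _).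
  apply: exec_fork; last exact: exec_seq (exec_prim _ _ _ _) (exec_prim _ _ _ _).
  apply: exec_seq; first exact: exec_prim.
  exact: exec_seq (exec_prim _ _ _ _) (exec_prim _ _ _ _).
- exact: ft'.
rewrite /= in bn bn' tb' *; rewrite mulSn nl.
rewrite (_ : size l - n.+1 = k) in tb'; last lia.
apply: leq_add tb'.
move: dl bn bn' tb.
move: (vsize (a n)) (vsize (a n.+1)) (vsize (vlist _)) (vsize (nth _ _ _)) (vsize (vlist _)) (vsize env).
move=> *; lia.
Qed.

(* The accumulator after [n] steps is [a x n]. *)
Lemma run_fold (X : Type) (K : X -> context) (D : X -> Prop)
    (l : X -> seq value) (env : X -> value) (a : X -> nat -> value) :
  let i x := VPair (a x 0) (VPair (vlist (l x)) (env x)) in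
  pbound (fun y : X * nat => D y.1 /\ y.2 <= size (l y.1)) (i \o fst)
    (fun y => vsize (a y.1 y.2)) ->
  run (K \o fst) (fun y : X * nat => D y.1 /\ y.2 < size (l y.1))
    (fun y => VPair (a y.1 y.2) (VPair (nth (VNat 0) (l y.1) y.2) (env y.1)))
    (fun y => a y.1 y.2.+1) ->
  run K D i (fun x => a x (size (l x))).
Proof.
move=> i [ca [da ha]] [f [c [d H]]].
(* [sz] bounds the input of each call of the body, and [b] bounds both the cost of a call and the
   size of the loop state. *)
pose sz x := ca * vsize (i x) ^ da + 2 * vsize (i x) + 2.
pose b x := c * sz x ^ d + sz x.
have szP : pbound D i sz.
  apply: pbound_add (pbound_const _ _ 2); apply: pbound_add; first by exists ca, da.
  by exists 2, 1.
have bP : pbound D i b.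
  apply: pbound_add (szP); case: szP => cs [ds hs].
  exists (c * cs ^ d), (ds * d) => x Dx; rewrite -mulnA leq_mul2l; apply/orP; right.
  by rewrite expnM -expnMn; case: (posnP d) => [->//|d0]; rewrite leq_exp2r // hs.
apply: run_seq (run_prim K D PFst
  (fun x => VPair (a x (size (l x))) (VPair (vlist [::]) (env x)))).
apply: (@runI _ _ _ _ _ _ (fun x => vsize (i x) * (40 * b x))).
  by apply: pbound_mul; [apply: pbound_size | apply: pbound_mul bP; apply: pbound_const].
move=> x Dx.
have [||//|t] := @exec_fold (K x).1 (K x).2 f (l x) (a x) (env x) (b x) 0.
- move=> n nl; have [//|t ft tb] := H (x, n).
  exists t => //; apply: leq_trans tb _; apply: leq_trans (leq_addr _ _).
  rewrite leq_mul2l; apply/orP; right; case: (posnP d) => [->//|d0].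
  rewrite leq_exp2r // /sz /=.
  have := ha (x, n) (conj Dx (ltnW nl)) => /=.
  suff : vsize (nth (VNat 0) (l x) n) <= vsize (vlist (l x)) by rewrite /i /=; lia.
  have := vsize_vlist_drop n (l x); rewrite (drop_nth (VNat 0)) //= => dl.
  by apply: leq_trans dl; rewrite leqW // leq_addr.
- move=> n nl; have := ha (x, n) (conj Dx nl); rewrite /b /sz /i /=; lia.
rewrite drop0 => ft tb; exists t; first exact: ft.
apply: leq_trans tb _; rewrite leq_mul2r subn0; apply/orP; right.
by have := size_vlist (l x); rewrite /i /=; lia.
Qed.

(** * Polynomial-time functions on coded types *)

Class encodable (T : Type) := encode : T -> value.
Arguments encode : simpl never.

#[export] Instance encodable_nat : encodable nat := VNat.
#[export] Instance encodable_bool : encodable bool := vbool.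
#[export] Instance encodable_pair (A B : Type) `{encodable A} `{encodable B} :
  encodable (A * B) := fun x => VPair (encode x.1) (encode x.2).
#[export] Instance encodable_seq (T : Type) `{encodable T} :
  encodable (seq T) := code_seq encode.

(* Since the context is arbitrary, the program makes no query. *)
Definition polytime (A B : Type) `{encodable A} `{encodable B} (f : A -> B) :=
  run (fun x : context * A => x.1) (fun=> True)
      (fun x => encode x.2) (fun x => encode (f x.2)).

Lemma run_poly (A B : Type) `{encodable A} `{encodable B} (f : A -> B)
    (X : Type) (K : X -> context) (D : X -> Prop) i o :
  polytime f ->
  (forall x, D x -> exists2 a, i x = encode a & o x = encode (f a)) ->
  run K D i o.
Proof.
move=> [g [c [d Hg]]] io; exists g, c, d => x /io[a -> ->].
exact: (Hg (K x, a)).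
Qed.

Lemma encode_vlist (T : Type) `{encodable T} (s : seq T) :
  encode s = vlist (map encode s).
Proof. by elim: s => //= x s IHs; rewrite -[encode _]/(VPair _ (encode s)) IHs. Qed.

Lemma size_encode (T : Type) `{encodable T} (s : seq T) : size s < vsize (encode s).
Proof. by rewrite encode_vlist -(size_map encode) size_vlist. Qed.

Section Poly.
Context {A : Type} `{encodable A}.

Lemma poly_size (B : Type) `{encodable B} (f : A -> B) :
  polytime f -> pbound (fun=> True) encode (fun a => vsize (encode (f a))).
Proof.
move=> /run_size[c [d Hf]]; exists c, d => a _.
exact: (Hf ((fun=> True, id), a)).
Qed.

Lemma poly_prim (B : Type) `{encodable B} (f : A -> B) p :
  (forall a, prim_eval p (encode a) = encode (f a)) -> polytime f.
Proof.
by move=> pf; apply: run_ext (run_prim _ _ p _) => // x _; apply: pf.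
Qed.

Lemma poly_id : polytime (fun a : A => a).
Proof. exact: run_id. Qed.

Lemma poly_const (B : Type) `{encodable B} (b : B) : polytime (fun _ : A => b).
Proof. exact: run_const. Qed.

Lemma poly_comp (B C : Type) `{encodable B} `{encodable C} (g : B -> C) (f : A -> B) :
  polytime g -> polytime f -> polytime (fun a => g (f a)).
Proof.
move=> pg pf; apply: (run_seq pf); apply: (run_poly _ pg) => x _.
by exists (f x.2).
Qed.

Lemma poly_ext (B : Type) `{encodable B} (f g : A -> B) :
  f =1 g -> polytime f -> polytime g.
Proof. by move=> fg; apply: run_ext => // x _; rewrite fg. Qed.

Lemma poly_pair (B C : Type) `{encodable B} `{encodable C} (f : A -> B) (g : A -> C) :
  polytime f -> polytime g -> polytime (fun a => (f a, g a)).
Proof. exact: run_fork. Qed.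

Lemma poly_fst (B C : Type) `{encodable B} `{encodable C} (f : A -> B * C) :
  polytime f -> polytime (fun a => (f a).1).
Proof. by move=> pf; apply: (@run_fst _ _ _ _ _ (fun x => encode (f x.2).2)). Qed.

Lemma poly_snd (B C : Type) `{encodable B} `{encodable C} (f : A -> B * C) :
  polytime f -> polytime (fun a => (f a).2).
Proof. by move=> pf; apply: (@run_snd _ _ _ _ (fun x => encode (f x.2).1)). Qed.

Lemma poly_if (B : Type) `{encodable B} (b : A -> bool) (f g : A -> B) :
  polytime b -> polytime f -> polytime g -> polytime (fun a => if b a then f a else g a).
Proof.
move=> pb pf pg; have := run_if pb (run_sub (fun _ _ => I) pf) (run_sub (fun _ _ => I) pg).
by apply: run_ext => // x _; case: (b x.2).
Qed.

Lemma poly_negb (b : A -> bool) : polytime b -> polytime (fun a => ~~ b a).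
Proof. by move=> pb; apply: poly_if pb (poly_const false) (poly_const true). Qed.

Lemma poly_andb (b b' : A -> bool) :
  polytime b -> polytime b' -> polytime (fun a => b a && b' a).
Proof. by move=> pb pb'; apply: poly_if pb pb' (poly_const false). Qed.

Lemma poly_orb (b b' : A -> bool) :
  polytime b -> polytime b' -> polytime (fun a => b a || b' a).
Proof. by move=> pb; apply: poly_if pb (poly_const true). Qed.

Lemma poly_cons (T : Type) `{encodable T} (f : A -> T) (g : A -> seq T) :
  polytime f -> polytime g -> polytime (fun a => f a :: g a).
Proof. exact: run_fork. Qed.

(** Stated for lists of lists because the default [[::]] has the code [VNat 0], which is what [PFst]
    returns on the code of the empty list. *)
Lemma poly_head (T : Type) `{encodable T} (f : A -> seq (seq T)) :
  polytime f -> polytime (fun a => head [::] (f a)).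
Proof.
move=> pf; apply: run_seq pf _.
apply: run_ext (run_prim _ _ PFst (fun x => encode (f x.2))) => // x _ /=.
by case: (f x.2).
Qed.

Lemma poly_behead (T : Type) `{encodable T} (f : A -> seq T) :
  polytime f -> polytime (fun a => behead (f a)).
Proof.
move=> pf; apply: run_seq pf _.
apply: run_ext (run_prim _ _ PSnd (fun x => encode (f x.2))) => // x _ /=.
by case: (f x.2).
Qed.

Lemma poly_isnil (T : Type) `{encodable T} (f : A -> seq T) :
  polytime f -> polytime (fun a => nilp (f a)).
Proof.
move=> pf; apply: (run_seq (run_fork pf (run_const _ _ _ (VNat 0)))).
apply: run_ext (run_prim _ _ PEq (fun x => VPair (encode (f x.2)) (VNat 0))) => // x _ /=.
by case: (f x.2).
Qed.

End Poly.

Section PolyNat.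
Context {A : Type} `{encodable A}.
Variables (f g : A -> nat).
Hypotheses (pf : polytime f) (pg : polytime g).

Lemma poly_addn : polytime (fun a => f a + g a).
Proof.
by apply: (poly_comp (g := fun x => x.1 + x.2) _ (poly_pair pf pg));
  apply: (poly_prim (p := PAdd)).
Qed.

Lemma poly_muln : polytime (fun a => f a * g a).
Proof.
by apply: (poly_comp (g := fun x => x.1 * x.2) _ (poly_pair pf pg));
  apply: (poly_prim (p := PMul)).
Qed.

Lemma poly_leq : polytime (fun a => f a <= g a).
Proof.
by apply: (poly_comp (g := fun x => x.1 <= x.2) _ (poly_pair pf pg));
  apply: (poly_prim (p := PLeq)).
Qed.

Lemma poly_eqn : polytime (fun a => f a == g a).
Proof.
by apply: (poly_comp (g := fun x => x.1 == x.2) _ (poly_pair pf pg));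
  apply: (poly_prim (p := PEq)).
Qed.

Lemma poly_succn : polytime (fun a => (f a).+1).
Proof.
apply: (poly_comp (g := S) _ pf); apply: (poly_ext (f := fun n => n + 1)).
  by move=> n; rewrite addn1.
apply: (poly_comp (g := fun x => x.1 + x.2) _ (poly_pair poly_id (poly_const 1))).
exact: (poly_prim (p := PAdd)).
Qed.

End PolyNat.

(** Iterating a polynomial-time step may produce exponentially large data, as repeated squaring
    does. Here one step enlarges the accumulator by at most an amount depending on the list element
    and the parameter, not on the accumulator, so the total growth is at most the length of the list
    times a polynomial. *)
Lemma poly_foldl (A S T : Type) {eA : encodable A} {eS : encodable S} {eT : encodable T}
    (g : A -> S -> T -> S) (s0 : A -> S) (l : A -> seq T) (h : T * A -> nat) :
  pbound (fun=> True) encode h ->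
  (forall a s t, vsize (encode (g a s t)) <= vsize (encode s) + h (t, a)) ->
  polytime (fun y : S * (T * A) => g y.2.2 y.1 y.2.1) -> polytime s0 -> polytime l ->
  polytime (fun a => foldl (g a) (s0 a) (l a)).
Proof.
move=> [c [d hb]] gh pg ps pl.
pose L (x : context * A) := map (@encode T eT) (l x.2).
pose a (x : context * A) n := @encode S eS (foldl (g x.2) (s0 x.2) (take n (l x.2))).
have asz x n : n <= size (L x) -> vsize (a x n) <=
    vsize (encode (s0 x.2)) + n * (c * vsize (VPair (vlist (L x)) (encode x.2)) ^ d).
  rewrite /a /L size_map; elim: n => [|n IHn] nl; first by rewrite take0 addn0.
  have [t u e] : exists2 t, drop n (l x.2) = t :: drop n.+1 (l x.2) & True.
    by case: (l x.2) nl => // t0 l' nl; exists (nth t0 (t0 :: l') n); rewrite -?drop_nth.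
  have -> : take n.+1 (l x.2) = rcons (take n (l x.2)) t.
    by rewrite -addn1 takeD u /= take0 cats1.
  rewrite foldl_rcons; apply: leq_trans (gh _ _ _) _.
  rewrite mulSn [_ + n * _]addnC addnA; apply: leq_add; first exact: IHn (ltnW nl).
  apply: leq_trans (hb _ I) _; rewrite leq_mul2l; apply/orP; right.
  case: (posnP d) => [->//|d0]; rewrite leq_exp2r // /= ltnS leq_add2r.
  rewrite -encode_vlist -(cat_take_drop n (l x.2)) u.
  elim: (take n (l x.2)) => [|y w IH] /=; first by rewrite leqW // leq_addr.
  by apply: leq_trans IH _; rewrite leqW // leq_addl.
apply: (run_seq (m := fun x => VPair (a x 0) (VPair (vlist (L x)) (encode x.2)))).
  apply: run_fork; first by apply: run_ext ps => // x _; rewrite /a take0.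
  apply: run_fork (run_id _ _ _); apply: run_ext pl => // x _.
  by rewrite encode_vlist.
apply: (run_ext (i := fun x => VPair (a x 0) (VPair (vlist (L x)) (encode x.2)))
                (o := fun x => a x (size (L x)))) => //.
  by move=> x _; rewrite /a size_map take_size.
apply: run_fold; last first.
- apply: run_poly pg _ => -[x n] /= [_ nl].
  rewrite size_map in nl.
  have [t u e] : exists2 t, drop n (l x.2) = t :: drop n.+1 (l x.2) & True.
    by case: (l x.2) nl => // t0 l' nl; exists (nth t0 (t0 :: l') n); rewrite -?drop_nth.
  exists (foldl (g x.2) (s0 x.2) (take n (l x.2)), (t, x.2)).
    congr VPair; congr VPair; rewrite /L (nth_map t) //; congr encode.
    by rewrite -[n]addn0 -nth_drop u.
  rewrite /a /=; have -> : take n.+1 (l x.2) = rcons (take n (l x.2)) t.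
    by rewrite -addn1 takeD u /= take0 cats1.
  by rewrite foldl_rcons.
- pose i (x : context * A) := VPair (a x 0) (VPair (vlist (L x)) (@encode A eA x.2)).
  apply: (@pbound_le _ _ _ _ (fun y : context * A * nat =>
    vsize (i y.1) + vsize (i y.1) * (c * vsize (i y.1) ^ d))).
    move=> [x n] /= [_ nl]; apply: leq_trans (asz _ _ nl) _.
    apply: leq_add; first by rewrite /i /a take0 /= leqW // leq_addr.
    apply: leq_mul.
      apply: leq_trans nl _; apply: leq_trans (ltnW (size_vlist _)) _.
      by rewrite /i /=; lia.
    rewrite leq_mul2l; apply/orP; right.
    by case: (posnP d) => [->//|d0]; rewrite leq_exp2r // /i /=; lia.
  apply: pbound_add; first exact: pbound_size.
  apply: pbound_mul; first exact: pbound_size.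
  by exists c, d.
Qed.

Lemma vsize_cons (T : Type) `{encodable T} (x : T) (s : seq T) :
  vsize (encode (x :: s)) = (vsize (encode x) + vsize (encode s)).+1.
Proof. by []. Qed.

Lemma vsize_pair (A B : Type) `{encodable A} `{encodable B} (x : A * B) :
  vsize (encode x) = (vsize (encode x.1) + vsize (encode x.2)).+1.
Proof. by []. Qed.

Lemma vsize_encode_bool (b : bool) : vsize (encode b) = 1.
Proof. exact: vsize_bool. Qed.

Lemma vsize_catrev (T : Type) `{encodable T} (s1 s2 : seq T) :
  vsize (encode (catrev s1 s2)) <= vsize (encode s1) + vsize (encode s2).
Proof.
elim: s1 s2 => [|x s1 IHs] s2; first exact: leq_addl.
by apply: leq_trans (IHs _) _; rewrite !vsize_cons; lia.
Qed.

Lemma poly_catrev {A T : Type} `{encodable A} `{encodable T} (l1 l2 : A -> seq T) :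
  polytime l1 -> polytime l2 -> polytime (fun a => catrev (l1 a) (l2 a)).
Proof.
move=> p1 p2; apply: (poly_ext (f := fun a => foldl (fun s x => x :: s) (l2 a) (l1 a))).
  by move=> a; elim: (l1 a) (l2 a) => //= x s IHs s2.
apply: (poly_foldl (h := fun y => vsize (encode y))) (pbound_size _ _) _ _ p2 p1.
  by move=> a s t; rewrite vsize_cons vsize_pair /=; lia.
apply: poly_cons; first by apply: poly_fst; apply: poly_snd; apply: poly_id.
by apply: poly_fst; apply: poly_id.
Qed.

Section PolySeq.
Context {A T U : Type} `{encodable A} `{encodable T} `{encodable U}.
Variable l : A -> seq T.
Hypothesis pl : polytime l.

Lemma poly_rev : polytime (fun a => rev (l a)).
Proof. exact: poly_catrev pl (poly_const [::]). Qed.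

Lemma poly_size_seq : polytime (fun a => size (l a)).
Proof.
apply: (poly_ext (f := fun a => foldl (fun n _ => n.+1) 0 (l a))).
  move=> a; rewrite -[size _]addn0; elim: (l a) 0 => //= x s IHs n.
  by rewrite IHs addnS.
apply: (poly_foldl (h := fun=> 1)) (pbound_const _ _ 1) _ _ (poly_const 0) pl.
  by move=> a n t; rewrite -addn1; apply: vsize_add.
by apply: poly_succn; apply: poly_fst; apply: poly_id.
Qed.

Lemma poly_flatten_map (f : A -> T -> seq U) :
  polytime (fun y : T * A => f y.2 y.1) ->
  polytime (fun a => flatten [seq f a x | x <- l a]).
Proof.
move=> pf; apply: (poly_ext (f := fun a =>
    rev (foldl (fun s x => catrev (f a x) s) [::] (l a)))).
  move=> a; rewrite -[flatten _]cat0s -[X in X ++ _]/(rev [::]).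
  elim: (l a) [::] => [|x s' IHs] s /=; first by rewrite cats0.
  by rewrite IHs catrevE rev_cat revK catA.
apply: poly_catrev (poly_const [::]).
apply: (poly_foldl (h := fun y : T * A => vsize (encode (f y.2 y.1))))
  (poly_size pf) _ _ (poly_const _) pl.
  by move=> a s t; rewrite addnC; apply: vsize_catrev.
apply: poly_catrev; last by apply: poly_fst; apply: poly_id.
by apply: (poly_comp pf); apply: poly_snd; apply: poly_id.
Qed.

Lemma poly_map (f : A -> T -> U) :
  polytime (fun y : T * A => f y.2 y.1) -> polytime (fun a => [seq f a x | x <- l a]).
Proof.
move=> pf; apply: (poly_ext (f := fun a => flatten [seq [:: f a x] | x <- l a])).
  by move=> a; rewrite flatten_map1.
by apply: poly_flatten_map; apply: poly_cons pf (poly_const _).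
Qed.

End PolySeq.

Section PolyFilter.
Context {A T : Type} `{encodable A} `{encodable T}.
Variables (l : A -> seq T) (p : A -> T -> bool).
Hypotheses (pl : polytime l) (pp : polytime (fun y : T * A => p y.2 y.1)).

Lemma poly_filter : polytime (fun a => [seq x <- l a | p a x]).
Proof.
apply: (poly_ext (f := fun a =>
    flatten [seq if p a x then [:: x] else [::] | x <- l a])).
  by move=> a; elim: (l a) => //= x s <-; case: (p a x).
apply: poly_flatten_map pl _ _; apply: poly_if pp _ (poly_const [::]).
by apply: poly_cons (poly_const [::]); apply: poly_fst; apply: poly_id.
Qed.

Lemma poly_has : polytime (fun a => has (p a) (l a)).
Proof.
apply: (poly_ext (f := fun a => ~~ nilp [seq x <- l a | p a x])).
  by move=> a; rewrite /nilp size_filter has_count lt0n.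
exact: poly_negb (poly_isnil poly_filter).
Qed.

Lemma poly_count : polytime (fun a => count (p a) (l a)).
Proof.
apply: (poly_ext (f := fun a => size [seq x <- l a | p a x])).
  by move=> a; rewrite size_filter.
exact: poly_size_seq poly_filter.
Qed.

End PolyFilter.

Lemma poly_all {A T : Type} `{encodable A} `{encodable T}
    (l : A -> seq T) (p : A -> T -> bool) :
  polytime l -> polytime (fun y : T * A => p y.2 y.1) -> polytime (fun a => all (p a) (l a)).
Proof.
move=> pl pp; apply: (poly_ext (f := fun a => ~~ has (fun x => ~~ p a x) (l a))).
  by move=> a; rewrite -all_predC; apply: eq_all => x /=; rewrite negbK.
by apply: poly_negb; apply: poly_has pl _; apply: poly_negb.
Qed.

Lemma poly_eq_pair {A : Type} `{encodable A} (f g : A -> nat * nat) :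
  polytime f -> polytime g -> polytime (fun a => f a == g a).
Proof.
move=> pf pg; apply: (poly_ext (f := fun a => ((f a).1 == (g a).1) && ((f a).2 == (g a).2))).
  by move=> a; rewrite -pair_eqE.
by apply: poly_andb; apply: poly_eqn;
  [apply: poly_fst | apply: poly_fst | apply: poly_snd | apply: poly_snd].
Qed.

Lemma poly_mem {A : Type} `{encodable A} (f : A -> nat) (l : A -> seq nat) :
  polytime f -> polytime l -> polytime (fun a => f a \in l a).
Proof.
move=> pf pl; apply: (poly_ext (f := fun a => has (fun x => x == f a) (l a))).
  by move=> a; rewrite has_pred1.
apply: poly_has pl _; apply: poly_eqn; first by apply: poly_fst; apply: poly_id.
by apply: (poly_comp pf); apply: poly_snd; apply: poly_id.
Qed.

Lemma poly_mem_pair {A : Type} `{encodable A} (f : A -> nat * nat) (l : A -> seq (nat * nat)) :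
  polytime f -> polytime l -> polytime (fun a => f a \in l a).
Proof.
move=> pf pl; apply: (poly_ext (f := fun a => has (fun x => x == f a) (l a))).
  by move=> a; rewrite has_pred1.
apply: poly_has pl _; apply: poly_eq_pair; first by apply: poly_fst; apply: poly_id.
by apply: (poly_comp pf); apply: poly_snd; apply: poly_id.
Qed.

(** * Syntax-directed proofs of polynomial time, and oracle programs with a precomputed list of
    queries *)

Ltac poly_hyp :=
  match goal with
  | H : polytime ?f |- polytime (fun y => ?f (@?g y)) =>
      apply: (poly_comp (g := f) (f := g) H)
  end.

Ltac poly_step :=
  lazymatch goal with
  | |- polytime (fun x => x) => apply: poly_id
  | |- polytime fst => apply: (poly_fst poly_id)
  | |- polytime snd => apply: (poly_snd poly_id)
  | |- polytime (fun _ => ?c) => apply: poly_const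
  | |- polytime (fun x => (@?f x).1) => apply: (poly_fst (f := f))
  | |- polytime (fun x => (@?f x).2) => apply: (poly_snd (f := f))
  | |- polytime (fun x => (_, _)) => apply: poly_pair
  | |- polytime (fun x => if _ then _ else _) => apply: poly_if
  | |- polytime (fun x => ~~ _) => apply: poly_negb
  | |- polytime (fun x => _ && _) => apply: poly_andb
  | |- polytime (fun x => _ || _) => apply: poly_orb
  | |- polytime (fun x => _ + _) => apply: poly_addn
  | |- polytime (fun x => _ * _) => apply: poly_muln
  | |- polytime (fun x => _.+1) => apply: poly_succn
  | |- polytime (fun x => _ <= _) => apply: poly_leq
  | |- polytime (fun x => nilp _) => apply: poly_isnil
  | |- polytime (fun x => _ :: _) => apply: poly_cons
  | |- polytime (fun x => head [::] _) => apply: poly_head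
  | |- polytime (fun x => filter _ _) => apply: poly_filter
  | |- polytime (fun x => has _ _) => apply: poly_has
  | |- polytime (fun x => all _ _) => apply: poly_all
  | |- polytime (fun x => count _ _) => apply: poly_count
  | |- polytime (fun x => flatten (map _ _)) => apply: poly_flatten_map
  | |- polytime (fun x => map fst _) => apply: (@poly_map _ _ _ _ _ _ _ _ (fun _ e => e.1))
  | |- polytime (fun x => map snd _) => apply: (@poly_map _ _ _ _ _ _ _ _ (fun _ e => e.2))
  | |- polytime (fun x => map _ _) => apply: poly_map
  | |- polytime (fun x => _ == _) => first [apply: poly_eqn | apply: poly_eq_pair]
  | |- polytime (fun x => _ \in _) => first [apply: poly_mem | apply: poly_mem_pair]
  end; cbv beta.

Ltac poly_tac := cbv beta; repeat first [assumption | poly_hyp | poly_step].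

(** The program computes all queries with [pre], asks them in turn, and combines the answers with
    [post]. A bound on the size of correct answers is required since reading an answer is charged.
    Correctness is to be shown for every function [g] that answers the queries correctly, which
    hides the oracle and its codes. *)
Lemma poly_reducible_by_queries (P Q : problem) (A : Type) (B : eqType) (C R : Type)
    {eA : encodable A} {eB : encodable B} {eC : encodable C} {eR : encodable R}
    (data : instance P -> A) (pre : A -> seq B) (post : A * seq C -> R) (c0 : C) :
  (forall I, code I = encode (data I)) ->
  polytime pre -> polytime post ->
  (forall I, valid I -> forall b, b \in pre (data I) -> is_instance Q (encode b)) ->
  (exists c d, forall J : instance Q, valid J -> forall y, correct J y ->
     exists2 a : C, y = encode a & vsize y <= c * vsize (code J) ^ d) ->
  (forall I, valid I -> forall g : B -> C,
     (forall b, b \in pre (data I) -> forall J : instance Q, valid J ->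
        code J = encode b -> correct J (encode (g b))) ->
     correct I (encode (post (data I, map g (pre (data I)))))) ->
  poly_reducible P Q.
Proof.
move=> codeE ppre ppost inst [ca [da ans]] fin.
pose X : Type := ((value -> value) * instance P)%type.
pose K (x : X) : context := (is_instance Q, x.1).
pose D (x : X) := solves Q x.1 /\ valid x.2.
(* The typed reading of the oracle; the default [c0] is never taken on a query that codes an
   instance. *)
pose g (O : value -> value) (b : B) :=
  if pselect (exists a : C, O (@encode B eB b) = @encode C eC a) is left h
  then projT1 (cid h) else c0.
have ansP O (b : B) : solves Q O -> is_instance Q (encode b) -> exists2 a : C,
    O (encode b) = encode a & vsize (O (encode b)) <= ca * vsize (encode b) ^ da.
  by move=> sO [J vJ bJ]; rewrite bJ; apply: (ans J vJ); apply: sO.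
have gP O (b : B) : solves Q O -> is_instance Q (encode b) ->
    O (encode b) = encode (g O b).
  move=> sO bi; rewrite /g; case: pselect => [h|[]]; first exact: projT2 (cid h).
  by have [a -> _] := ansP O b sO bi; exists a.
pose bs (x : X) := pre (data x.2).
pose L (x : X) := map (@encode B eB) (bs x).
(* Answers are pushed in front as they arrive, so they stay in reverse order until [poly_rev] is
   applied at the end. *)
pose a (x : X) n := vlist (rev (map x.1 (take n (L x)))).
pose i (x : X) := VPair (a x 0) (VPair (vlist (L x)) (VNat 0)).
have LP x n : n < size (L x) -> exists2 b, b \in bs x & nth (VNat 0) (L x) n = encode b.
  by move=> nL; apply/mapP; apply: mem_nth.
have nthsz x n : n < size (L x) -> vsize (nth (VNat 0) (L x) n) <= vsize (vlist (L x)).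
  move=> nL; have := vsize_vlist_drop n (L x); rewrite (drop_nth (VNat 0)) //= => h.
  by apply: leq_trans h; rewrite leqW // leq_addr.
have runL : run K D (fun x => encode (data x.2)) (fun x => a x (size (L x))).
  apply: (run_seq (m := i)).
    apply: run_fork.
      by apply: run_ext (run_const _ _ _ (VNat 0)) => // x _; rewrite /a take0.
    apply: run_fork; last exact: run_const.
    apply: run_poly ppre _ => x _; exists (data x.2) => //.
    by rewrite encode_vlist.
  apply: run_fold.
    apply: (@pbound_le _ _ _ _ (fun y : X * nat =>
      vsize (i y.1) * (ca * vsize (i y.1) ^ da + 1) + 1)); last first.
      apply: pbound_add (pbound_const _ _ 1).
      apply: pbound_mul; first exact: pbound_size.
      by apply: pbound_add (pbound_const _ _ 1); exists ca, da.
    move=> [x n] /= [[sO vI] nL]; apply: (@leq_trans (n * (ca * vsize (i x) ^ da + 1) + 1)).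
      elim: n nL => [|n IHn] nL; first by rewrite /a take0.
      have -> : a x n.+1 = VPair (x.1 (nth (VNat 0) (L x) n)) (a x n).
        by rewrite /a (take_nth (VNat 0)) // map_rcons rev_rcons.
      have := IHn (ltnW nL); rewrite /= mulSn.
      suff : vsize (x.1 (nth (VNat 0) (L x) n)) <= ca * vsize (i x) ^ da.
        set q := ca * _; set m := n * _; lia.
      have := nthsz x _ nL; have [b bin ->] := LP _ _ nL => bsz.
      have [|y _ yb] := ansP x.1 b sO; first exact: inst bin.
      apply: leq_trans yb _; rewrite leq_mul2l; apply/orP; right.
      case: (posnP da) => [->//|d0]; rewrite leq_exp2r //.
      by apply: leq_trans bsz _; rewrite /i /=; lia.
    rewrite leq_add2r leq_mul2r; apply/orP; right.
    by rewrite /i /=; have := size_vlist (L x); lia.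
  apply: (run_ext (o := fun y => VPair (y.1.1 (nth (VNat 0) (L y.1) y.2)) (a y.1 y.2))) => //.
    by move=> [x n] /= [_ nL]; rewrite /a (take_nth (VNat 0)) // map_rcons rev_rcons.
  apply: run_fork; last exact: run_prim PFst _.
  apply: (run_seq (m := fun y => nth (VNat 0) (L y.1) y.2)).
    apply: run_seq; first exact: run_prim PSnd _.
    exact: run_prim PFst _.
  apply: (run_query (K := K \o fst)) => [[x n] /= [[sO vI] nL]|].
    by have [b bin ->] := LP _ _ nL; apply: inst bin.
  exists ca, da => -[x n] /= [[sO vI] nL]; have [b bin ->] := LP _ _ nL.
  by have [|y _ yb] := ansP x.1 b sO; first exact: inst bin.
have runA : run K D (fun x => encode (data x.2))
    (fun x => encode (data x.2, map (g x.1) (bs x))).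
  apply: run_fork; first exact: run_id.
  apply: (run_seq runL).
  apply: (run_poly (f := fun s : seq C => rev s)) => [|x [sO vI]].
    exact: poly_rev poly_id.
  exists (rev (map (g x.1) (bs x))); last by rewrite revK.
  rewrite encode_vlist map_rev /a take_size /L -!map_comp; congr (vlist (rev _)).
  by apply/eq_in_map => b bin /=; apply: gP => //; apply: inst bin.
have [f [c [d H]]] : run K D (fun x => encode (data x.2))
    (fun x => encode (post (data x.2, map (g x.1) (bs x)))).
  by apply: (run_seq runA); apply: run_poly ppost _ => x _; exists (data x.2, map (g x.1) (bs x)).
exists f, c, d => O sO I vI; have [t ft tb] := H (O, I) (conj sO vI).
eexists; exists t; split; [rewrite codeE; exact: ft | | by rewrite codeE].
apply: fin => // b bin J vJ e; rewrite -gP //; last exact: inst bin.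
by rewrite -e; apply: sO.
Qed.

(** * Skeletons *)

(** The arcs are listed in an order in which a tree grows out of [seen]: each leaves a vertex
    already reached and reaches a new one. Rooted trees are thus recognized in one pass. *)
Fixpoint topological (seen : seq nat) (q : seq arc) : bool :=
  if q is e :: q' then
    [&& e.1 \in seen, e.2 \notin seen & topological (e.2 :: seen) q']
  else true.

(** One pass finds all vertices reachable from [D] when [q] is in topological order, since an arc
    into a vertex precedes the arcs out of it. *)
Definition descendants (D : seq nat) (q : seq arc) : seq nat :=
  foldl (fun D e => if e.1 \in D then e.2 :: D else D) D q.

Lemma topological_heads seen q x :
  topological seen q -> x \in seen -> x \notin map snd q.
Proof.
elim: q seen => //= e q IHq seen /and3P[_ es tq] xs.
rewrite inE negb_or (IHq _ tq) ?inE ?xs ?orbT // andbT.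
by apply: contraNneq es => <-.
Qed.

Lemma topological_uniq seen q : topological seen q -> uniq (map snd q).
Proof.
elim: q seen => //= e q IHq seen /and3P[_ _ tq].
by rewrite (IHq _ tq) (topological_heads tq) ?mem_head.
Qed.

Lemma topological_loopless seen q e : topological seen q -> e \in q -> e.1 != e.2.
Proof.
elim: q seen => //= f q IHq seen /and3P[fs fs' tq].
rewrite inE => /orP[/eqP->|/(IHq _ tq)//].
by apply: contraNneq fs' => <-.
Qed.

Lemma topological_tails seen q e :
  topological seen q -> e \in q -> (e.1 \in seen) || (e.1 \in map snd q).
Proof.
elim: q seen => //= f q IHq seen /and3P[fs fs' tq].
rewrite inE => /orP[/eqP->|/(IHq _ tq)]; first by rewrite fs.
by rewrite !inE -orbA; case/or3P => ->; rewrite ?orbT.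
Qed.

Lemma topological_sub seen seen' q :
  {subset seen <= seen'} -> (forall x, x \in map snd q -> x \notin seen') ->
  topological seen q -> topological seen' q.
Proof.
elim: q seen seen' => //= e q IHq seen seen' ss h /and3P[es es' tq].
rewrite ss // h ?mem_head //=; apply: IHq (tq).
  by move=> x; rewrite !inE => /orP[->//|/ss->]; rewrite orbT.
move=> x xq; rewrite inE negb_or h ?inE ?xq ?orbT // andbT.
apply: contraTneq xq => ->; exact: topological_heads tq (mem_head _ _).
Qed.

Lemma topological_cat seen q1 q2 :
  topological seen (q1 ++ q2) =
  topological seen q1 && topological (rev (map snd q1) ++ seen) q2.
Proof.
elim: q1 seen => //= e q1 IHq seen; rewrite IHq rev_cons cat_rcons.
by rewrite -!andbA.
Qed.

Lemma descendants_sub D q : {subset D <= descendants D q}.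
Proof.
elim: q D => [|e q IHq] D x //= xD; apply: (IHq _ x).
by case: ifP => // _; rewrite inE xD orbT.
Qed.

Lemma descendants_ind (R : nat -> Prop) D q :
  (forall x, x \in D -> R x) -> (forall e, e \in q -> R e.1 -> R e.2) ->
  forall x, x \in descendants D q -> R x.
Proof.
elim: q D => [|e q IHq] D hD hq /=; first exact: hD.
apply: IHq => [x|f fq]; last first.
  by apply: hq; rewrite inE fq orbT.
case: ifP => eD; last exact: hD.
by rewrite inE => /orP[/eqP->|/hD//]; apply: hq (mem_head _ _) (hD _ eD).
Qed.

(** An arc could be missed only if its tail were collected after the arc had been read. The tail
    would then be the head of a later arc, although it had been seen before. *)
Lemma descendants_closed seen D q e :
  topological seen q -> e \in q ->
  e.1 \in descendants D q -> e.2 \in descendants D q.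
Proof.
elim: q seen D => //= f q IHq seen D /and3P[fs fs' tq].
rewrite inE => /orP[/eqP->|/(IHq _ _ tq)]; last exact.
set D' := if _ then _ else _ => h.
suff fD : f.1 \in D by apply: descendants_sub; rewrite /D' fD mem_head.
apply: contraT => fD; move: h; rewrite /D' (negbTE fD) => h.
have [fD'|fq] : f.1 \in D \/ f.1 \in map snd q.
  apply: (descendants_ind (R := fun x => x \in D \/ x \in map snd q)) h.
    by left.
  by move=> e' e'q _; right; apply: map_f.
  by rewrite fD' in fD.
have fs2 : f.1 \in f.2 :: seen by rewrite inE fs orbT.
by have := topological_heads tq fs2; rewrite fq.
Qed.

Lemma path_subset (A : seq arc) x p :
  path (adj A) x p = all (mem A) (path_arcs (x :: p)).
Proof. by elim: p x => //= y p IHp x; rewrite IHp. Qed.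

Lemma reach_refl A x : reach A x x.
Proof. by exists [::]. Qed.

Lemma reach_trans A y x z : reach A x y -> reach A y z -> reach A x z.
Proof.
by move=> [p xp <-] [p' yp <-]; exists (p ++ p'); rewrite ?cat_path ?xp ?last_cat.
Qed.

Lemma reach_closed A (S : nat -> Prop) x y :
  (forall e, e \in A -> S e.1 -> S e.2) -> S x -> reach A x y -> S y.
Proof.
move=> cl Sx [p xp <-]; elim: p x Sx xp => //= z p IHp x Sx /andP[xz zp].
by apply: IHp zp; apply: cl xz Sx.
Qed.

Lemma path_reach A x p y : path (adj A) x p -> y \in x :: p -> reach A x y.
Proof.
rewrite inE => xp /orP[/eqP->|yp]; first exact: reach_refl.
case/splitPr: p / yp xp => p1 p2; rewrite cat_path => /andP[xp1 /andP[p1y _]].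
by exists (rcons p1 y); rewrite ?last_rcons // rcons_path xp1.
Qed.

Lemma uniq_map_inj (T U : eqType) (f : T -> U) s :
  uniq (map f s) -> {in s &, injective f}.
Proof.
elim: s => //= z s IHs /andP[zs us] x y; rewrite !inE.
case/predU1P=> [->|xs] /predU1P[->|ys] // e; last exact: IHs e.
  by rewrite e map_f in zs.
by rewrite -e map_f in zs.
Qed.

(** No two arcs share a head and none enters the root. Read from its end, a walk from the root is
    therefore forced at every step, including where it stops. *)
Lemma tree_from_heads r A :
  uniq (map snd A) -> r \notin map snd A ->
  (forall v, v \in tree_verts r A -> reach A r v) -> tree_from r A.
Proof.
move=> uA rA rch; split; first exact: map_uniq uA.
move=> v /rch[p rp pv]; exists p; split=> // p' [rp' pv'] {rch}.
elim/last_ind: p v p' rp pv rp' pv' => [|p x IHp] v p' rp pv rp' pv'.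
  elim/last_ind: p' rp' pv' => // p' y _; rewrite rcons_path last_rcons.
  by move=> /andP[_ /(map_f snd)] + yv; rewrite /= yv -pv => /(negP rA).
move: rp pv; rewrite rcons_path last_rcons => /andP[rp px] xv.
elim/last_ind: p' rp' pv' => [_ /= rv|p' y _].
  by have := map_f snd px; rewrite /= xv -rv => /(negP rA).
rewrite rcons_path last_rcons => /andP[rp' py] yv.
have e : last r p = last r p'.
  suff /(congr1 fst) : (last r p, x) = (last r p', y) by [].
  by apply: (uniq_map_inj uA px py); rewrite /= xv yv.
by rewrite xv -yv (IHp _ p' rp erefl rp').
Qed.

(** * Path systems *)

(* A pair [(u, p)] is the path with first vertex [u] and further vertices [p]. *)
Definition skeleton (P : seq (nat * seq nat)) : seq arc :=
  [seq (e.1, last e.1 e.2) | e <- P].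

Definition psys_verts (P : seq (nat * seq nat)) : seq nat := flatten (map snd P).

Definition psys_arcs (P : seq (nat * seq nat)) : seq arc :=
  flatten [seq path_arcs (e.1 :: e.2) | e <- P].

(* The paths grow a tree: [psys_verts] omits the starting vertex of each path, *)
(* which is the root or the end of an earlier path.                           *)
Definition path_system (A : seq arc) (r : nat) (P : seq (nat * seq nat)) : Prop :=
  [/\ uniq (r :: psys_verts P),
      all (fun e => path (adj A) e.1 e.2 && ~~ nilp e.2) P &
      topological [:: r] (skeleton P)].

Lemma last_mem (T : eqType) (x : T) p : ~~ nilp p -> last x p \in p.
Proof. by case: p => //= y p _; apply: mem_last. Qed.

Implicit Type P : seq (nat * seq nat).

Lemma mem_psys_verts P e x : e \in P -> x \in e.2 -> x \in psys_verts P.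
Proof. by move=> eP xe; apply/flattenP; exists e.2 => //; apply: map_f. Qed.

Lemma psys_verts_inj P e e' x : uniq (psys_verts P) ->
  e \in P -> e' \in P -> x \in e.2 -> x \in e'.2 -> e = e'.
Proof.
elim: P => //= f P IHP; rewrite /psys_verts /= cat_uniq => /and3P[_ dj uP].
rewrite !inE => /predU1P[->|eP] /predU1P[->|eP'] // xe xe'; last exact: IHP xe xe'.
  by case/hasP: dj; exists x => //; apply: mem_psys_verts eP' xe'.
by case/hasP: dj; exists x => //; apply: mem_psys_verts eP xe.
Qed.

Lemma psys_arcs_heads P : map snd (psys_arcs P) = psys_verts P.
Proof.
rewrite /psys_arcs /psys_verts map_flatten -map_comp; congr flatten.
by apply: eq_map => e /=; rewrite -/unzip2 unzip2_zip //= leqW.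
Qed.

Lemma path_arcs_tails x p e : e \in path_arcs (x :: p) -> e.1 \in x :: p.
Proof.
elim: p x => //= y p IHp x; rewrite !inE => /predU1P[->|/IHp]; first by rewrite eqxx.
by rewrite inE => ->; rewrite orbT.
Qed.

Lemma path_arcs_heads x p e : e \in path_arcs (x :: p) -> e.2 \in p.
Proof.
elim: p x => //= y p IHp x; rewrite !inE => /predU1P[->|/IHp ->]; first by rewrite eqxx.
by rewrite orbT.
Qed.

Lemma psys_arcsP P a : reflect (exists2 e, e \in P & a \in path_arcs (e.1 :: e.2))
  (a \in psys_arcs P).
Proof.
apply: (iffP flattenP) => [[s /mapP[e eP ->] as_]|[e eP ae]]; first by exists e.
by exists (path_arcs (e.1 :: e.2)) => //; apply: map_f.
Qed.

Section PathSystem.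
Variables (A : seq arc) (r : nat) (P : seq (nat * seq nat)).
Hypothesis psP : path_system A r P.

Lemma psys_path e : e \in P -> path (adj A) e.1 e.2.
Proof. by case: psP => _ /allP h _ /h /andP[]. Qed.

Lemma psys_nonnil e : e \in P -> ~~ nilp e.2.
Proof. by case: psP => _ /allP h _ /h /andP[]. Qed.

Lemma psys_arcs_sub : {subset psys_arcs P <= A}.
Proof.
move=> a /psys_arcsP[e eP]; apply: allP a.
by rewrite -path_subset psys_path.
Qed.

Lemma psys_last e : e \in P -> last e.1 e.2 \in psys_verts P.
Proof. by move=> eP; apply: mem_psys_verts (eP) (last_mem _ (psys_nonnil eP)). Qed.

Lemma skeleton_heads_sub x : x \in map snd (skeleton P) -> x \in psys_verts P.
Proof. by rewrite -map_comp => /mapP[e eP ->]; apply: psys_last. Qed.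

Lemma psys_tails e : e \in P -> (e.1 == r) || (e.1 \in map snd (skeleton P)).
Proof.
case: psP => _ _ tP eP; have := topological_tails tP (map_f _ eP).
by rewrite inE.
Qed.

Lemma psys_arcs_uniq : uniq (psys_arcs P).
Proof.
by case: psP => /andP[_ uP] _ _; apply: (map_uniq (f := snd)); rewrite psys_arcs_heads.
Qed.

Lemma psys_reach x : x \in r :: psys_verts P -> reach (psys_arcs P) r x.
Proof.
case: psP => _ /allP hP tP; rewrite inE => /predU1P[->|]; first exact: reach_refl.
move=> /flattenP[_ /mapP[e0 eP0 ->] xe0].
have : forall e, e \in P -> e.2 != [::] by move=> e /hP/andP[_]; case: e.2.
have : {subset psys_arcs P <= psys_arcs P} by [].
have : forall y, y \in [:: r] -> reach (psys_arcs P) r y.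
  by move=> y; rewrite inE => /eqP->; apply: reach_refl.
(* [B] keeps the full arc set while the induction drops paths; the invariant is that all of [seen]
   can be reached in [B]. *)
move: {1 3 4}(psys_arcs P) [:: r] tP e0 eP0 x xe0 => B.
elim: (P) => //= f P' IHP seen /and3P[fs _ tP'] e eP' x xe sB BA ne.
have fB : {subset path_arcs (f.1 :: f.2) <= B}.
  by move=> a af; apply: BA; rewrite /psys_arcs /= mem_cat af.
have fr y : y \in f.2 -> reach B r y.
  move=> yf; apply: reach_trans (sB _ fs) _; apply: (path_reach (p := f.2)).
    by rewrite path_subset; apply/allP.
  by rewrite inE yf orbT.
move: eP'; rewrite inE => /predU1P[e_f|eP']; first by apply: fr; rewrite -e_f.
apply: (IHP _ tP' e eP' x xe) => [y|a aP'|e' eP''].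
- rewrite inE => /predU1P[->|/sB//]; apply: fr; apply: last_mem.
  by have := ne f (mem_head _ _); case: f.2.
- by apply: BA; rewrite /psys_arcs /= mem_cat aP' orbT.
- by apply: ne; rewrite inE eP'' orbT.
Qed.

Lemma psys_tree_verts : tree_verts r (psys_arcs P) =i r :: psys_verts P.
Proof.
move=> x; rewrite /tree_verts psys_arcs_heads !inE mem_cat.
case: (x == r) / eqP => //= xr; apply/orP/idP => [[|//]|->]; last by right.
case/mapP=> a /psys_arcsP[e eP ae] xa; move: (path_arcs_tails ae); rewrite -xa inE.
case/predU1P=> [xe|xe]; last exact: mem_psys_verts eP xe.
by have := psys_tails eP; rewrite -xe => /predU1P[//|]; apply: skeleton_heads_sub.
Qed.

Lemma psys_tree : tree_from r (psys_arcs P).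
Proof.
case: psP => /andP[rP uP] _ _; apply: tree_from_heads; rewrite ?psys_arcs_heads //.
by move=> v; rewrite psys_tree_verts; apply: psys_reach.
Qed.

(** The set [S] of vertices that lie on [e], or on a path starting at a descendant of the end of
    [e], is closed under arcs: paths share no vertices other than starting points, so an arc leads
    on along the same path or begins a path at the end of another one. A skeleton vertex in [S] is
    the end of a path in question, hence a descendant. *)
Lemma psys_descendants e x t :
  e \in P -> x \in e.2 -> reach (psys_arcs P) x t ->
  t \in r :: map snd (skeleton P) ->
  t \in descendants [:: last e.1 e.2] (skeleton P).
Proof.
move=> eP xe xt tP; case: psP => /andP[rP uP] _ topP.
set D := descendants _ _.
pose S y := exists2 f, f \in P & y \in f.2 /\ (f = e \/ f.1 \in D).
have eD : last e.1 e.2 \in D by apply: descendants_sub; rewrite mem_head.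
have DP f : f \in P -> f = e \/ f.1 \in D -> last f.1 f.2 \in D.
  move=> fP [->//|fD].
  exact: (descendants_closed (e := (f.1, last f.1 f.2)) topP (map_f _ fP)).
have lastS f y : f \in P -> S y -> y = last f.1 f.2 -> y \in D.
  move=> fP [g gP [yg h]] yf.
  suff gf : g = f by rewrite yf; apply: DP => //; rewrite -gf.
  by apply: (psys_verts_inj uP gP fP yg); rewrite yf last_mem ?psys_nonnil.
have St : S t.
  apply: (reach_closed (S := S)) xt; last by exists e => //; split=> //; left.
  move=> a /psys_arcsP[f fP af] Sa.
  have a2 := path_arcs_heads af; exists f => //; split=> //.
  move: (path_arcs_tails af); rewrite inE => /predU1P[a1|a1].
    right; have := psys_tails fP; rewrite -a1 => /predU1P[ar|].
      case: Sa => g gP [ag _]; case/negP: rP; rewrite -ar.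
      exact: mem_psys_verts gP ag.
    by rewrite -map_comp => /mapP[g gP ga]; apply: (lastS g).
  by case: Sa => g gP [ag h]; rewrite -(psys_verts_inj uP gP fP ag a1).
move: tP; rewrite inE => /predU1P[tr|]; last first.
  by rewrite -map_comp => /mapP[f fP tf]; apply: (lastS f).
case: St => g gP [tg _]; case/negP: rP; rewrite -tr; exact: mem_psys_verts gP tg.
Qed.

End PathSystem.

(** A vertex interior to a path cuts it in two. As [psys_verts] omits starting vertices, the list of
    vertices stays literally the same. *)
Lemma psys_split A r P x :
  path_system A r P -> x \in r :: psys_verts P ->
  exists P', [/\ path_system A r P', psys_verts P' = psys_verts P,
    {subset map snd (skeleton P) <= map snd (skeleton P')},
    x \in r :: map snd (skeleton P') & size P' <= (size P).+1].
Proof.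
move=> psP xP; have [xh|xh] := boolP (x \in r :: map snd (skeleton P)).
  by exists P; split.
move: (xh); rewrite inE negb_or => /andP[xr xh'].
move: xP; rewrite inE (negbTE xr) /= => /flattenP[_ /mapP[[u p] eP ->] /= xp].
case: psP => uP aP tP.
case/splitPr: P / eP xh xh' uP aP tP => P1 P2.
case/splitPr: p / xp => p1 p2 xh xh' uP aP tP.
have p2n : ~~ nilp p2.
  apply: contra xh' => /nilP p20; rewrite p20 /skeleton !map_cat /= last_cat /=.
  by rewrite mem_cat mem_head orbT.
exists (P1 ++ (u, rcons p1 x) :: (x, p2) :: P2).
have verts_eq : psys_verts (P1 ++ (u, rcons p1 x) :: (x, p2) :: P2) =
    psys_verts (P1 ++ (u, p1 ++ x :: p2) :: P2).
  by rewrite /psys_verts !map_cat !flatten_cat /= !cat_rcons -!catA.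
have last_eq : last u (p1 ++ x :: p2) = last x p2 by rewrite last_cat.
move: xh' tP; rewrite /skeleton !map_cat /= last_eq mem_cat inE !negb_or.
case/and3P => x1 xv x2.
rewrite topological_cat -/(skeleton P1) -/(skeleton P2) => /andP[t1 /= /and3P[us vs t2]].
have xs : x \notin rev (map snd (skeleton P1)) ++ [:: r].
  by rewrite mem_cat mem_rev (negbTE x1) inE.
split=> //.
- split; first by rewrite verts_eq.
    move: aP; rewrite !all_cat /= => /and3P[-> /andP[+ _] ->].
    rewrite cat_path /= => /and3P[up1 xp1 xp2].
    by rewrite rcons_path up1 xp1 xp2 p2n /nilp size_rcons.
  rewrite /skeleton map_cat /= topological_cat t1 /= last_rcons us mem_head xs /=.
  rewrite inE negb_or vs eq_sym xv /=; apply: topological_sub (t2).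
    by move=> y; rewrite !inE => /orP[->//|->]; rewrite !orbT.
  move=> y y2; rewrite !inE !negb_or; apply/and3P; split.
  - apply: contraTneq y2 => ->.
    exact: topological_heads t2 (mem_head _ _).
  - by apply: contraNneq x2 => <-.
  - apply: contraL y2 => ys; apply: topological_heads t2 _.
    by rewrite inE ys orbT.
- move=> y; rewrite /= last_rcons !mem_cat !inE.
  by case/or3P => ->; rewrite ?orbT.
- by rewrite /= last_rcons inE !mem_cat !inE eqxx !orbT.
- by rewrite !size_cat /= !addnS.
Qed.

Lemma psys_extend A r P x p :
  path_system A r P -> x \in r :: map snd (skeleton P) ->
  path (adj A) x p -> ~~ nilp p -> uniq p ->
  ~~ has (mem (r :: psys_verts P)) p -> path_system A r (rcons P (x, p)).
Proof.
move=> psP xh xp p0 up dj.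
have hsub := skeleton_heads_sub psP.
case: psP => uP aP tP; split.
- rewrite /psys_verts map_rcons flatten_rcons -cat_cons cat_uniq up andbT.
  by apply/andP; split.
- by rewrite all_rcons /= xp p0.
- rewrite /skeleton map_rcons -cats1 topological_cat tP /= andbT.
  rewrite !mem_cat !mem_rev !inE -/(skeleton P).
  rewrite inE in xh; rewrite orbC xh /= negb_or.
  have lp := last_mem x p0; have /hasPn/(_ _ lp) := dj.
  rewrite inE negb_or => /andP[lr lP]; rewrite lr andbT.
  by apply: contra lP; apply: hsub.
Qed.

(** The path is restarted at a visit to [W] until no later visit remains, and its loops are then
    removed. *)
Lemma path_escape (e : rel nat) (W : seq nat) r p :
  path e r p -> r \in W -> last r p \notin W ->
  exists x p', [/\ x \in W, path e x p', last x p' = last r p, uniq p' &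
                   ~~ has (mem W) p'].
Proof.
have [n] := ubnP (size p); elim: n r p => // n IHn r p pn rp rW lW.
have [/hasP[y yp yW]|dj] := boolP (has (mem W) p); last first.
  exists r; case/shortenP: rp lW => p' rp' /andP[_ up'] sub lW.
  exists p'; split=> //; apply: contra dj => /hasP[y yp' yW].
  by apply/hasP; exists y => //; apply: sub.
case/splitPr: p / yp pn rp lW => p1 p2 pn.
rewrite cat_path last_cat /= => /and3P[_ _ yp2] lW.
apply: (IHn y p2) => //; move: pn; rewrite size_cat /=; lia.
Qed.

(** Each terminal costs at most two paths: one by splitting where its new branch starts, one for the
    branch itself. *)
Lemma psys_exists A r ts :
  (forall t, t \in ts -> reach A r t) ->
  exists P, [/\ path_system A r P, {subset ts <= r :: map snd (skeleton P)} &
                size P <= 2 * size ts].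
Proof.
elim: ts => [|t ts IHts] h; first by exists [::].
have [P [psP sP zP]] : exists P, [/\ path_system A r P,
    {subset ts <= r :: map snd (skeleton P)} & size P <= 2 * size ts].
  by apply: IHts => t' t'ts; apply: h; rewrite inE t'ts orbT.
have ext P' : path_system A r P' -> psys_verts P' = psys_verts P ->
    {subset map snd (skeleton P) <= map snd (skeleton P')} ->
    {subset ts <= r :: map snd (skeleton P')}.
  move=> psP' vP' sP' y /sP; rewrite !inE => /orP[->//|/sP' ->].
  by rewrite orbT.
have [tP|tP] := boolP (t \in r :: psys_verts P).
  have [P' [psP' vP' sP' tP' zP']] := psys_split psP tP.
  exists P'; split=> //; last by rewrite /= mulnS (leq_trans zP') // ltnS leqW.
  by move=> y; rewrite inE => /predU1P[->//|]; apply: ext.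
have [p rp pt] := h t (mem_head _ _).
have [||x [p' [xW xp' lp' up' dj]]] := path_escape (W := r :: psys_verts P) rp.
- by rewrite mem_head.
- by rewrite pt.
have [P' [psP' vP' sP' xP' zP']] := psys_split psP xW.
have p'0 : ~~ nilp p'.
  by apply: contraNN tP => /nilP p'0; move: lp'; rewrite p'0 pt /= => <-.
exists (rcons P' (x, p')); split.
- by apply: psys_extend; rewrite ?vP'.
- move=> y; rewrite /skeleton map_rcons map_rcons /= lp' pt -rcons_cons mem_rcons.
  rewrite (in_cons t ts) (in_cons t (r :: _)) => /predU1P[->|yts]; first by rewrite eqxx.
  by apply/orP; right; apply: ext yts.
- by rewrite size_rcons /= mulnS !ltnS (leq_trans zP').
Qed.

(** * Splitting the vertices of a skeleton *)

(* An injective pairing computed with additions and multiplications only. *)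
Definition copy (x z : nat) : nat := (x + z) * (x + z) + x.

(** With [s = x + z], the code lies between [s * s] and [s * s + s], hence strictly below the next
    square. It determines [s], then [x], then [z]. *)
Lemma copy_inj x z x' z' : copy x z = copy x' z' -> (x, z) = (x', z').
Proof.
rewrite /copy => e; suff xz : x + z = x' + z'.
  by move: e; rewrite xz => /addnI e; move: xz; rewrite e => /addnI->.
have [lt|lt|//] := ltngtP (x + z) (x' + z'); nia.
Qed.

(** A left inverse of [copy], found by bounded search because neither component exceeds the code. It
    serves in specifications only: the search is exponential in the bit length, and the program
    avoids it. *)
Definition original (n : nat) : nat :=
  find (fun x => has (fun z => copy x z == n) (iota 0 n.+1)) (iota 0 n.+1).

Lemma copyK x z : original (copy x z) = x.
Proof.
rewrite /original; set a := fun _ => _.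
have xc : x < (copy x z).+1 by rewrite ltnS leq_addl.
have zc : z < (copy x z).+1 by rewrite ltnS /copy; nia.
have ax : has a (iota 0 (copy x z).+1).
  apply/hasP; exists x; rewrite ?mem_iota //; apply/hasP.
  by exists z; rewrite ?mem_iota //=.
have := nth_find 0 ax; rewrite nth_iota; last by rewrite has_find size_iota in ax.
by rewrite add0n => /hasP[z' _ /eqP/copy_inj[]].
Qed.

(* The vertex [x] is replaced by copies: [copy x x] to be crossed by a path of *)
(* the skeleton or to be its last vertex, and, for each arc [(x, z)] of the    *)
(* skeleton, [copy x z] to be the first vertex of the corresponding path.     *)
Definition copies (V : seq nat) (r : nat) (q : seq arc) (x : nat) : seq nat :=
  [seq z <- V | (x == z) && ~~ (x == r) || ((x, z) \in q)].

(** All pairs are taken, whatever the skeleton; those outside [copies] are isolated vertices. *)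
Definition split_verts (V : seq nat) : seq nat := [seq copy x z | x <- V, z <- V].

Definition split_arcs (V : seq nat) (A : seq arc) (r : nat) (q : seq arc) : seq arc :=
  [seq (copy e.1 zz.1, copy e.2 zz.2) | e <- A,
     zz <- [seq (z, z') | z <- copies V r q e.1, z' <- copies V r q e.2]].

Definition split_pairs (q : seq arc) : seq (nat * nat) :=
  [seq (copy e.1 e.2, copy e.2 e.2) | e <- q].

Definition merge_arc (a : arc) : arc := (original a.1, original a.2).

Definition split_instance (I : steiner) (q : seq arc) : vdisj :=
  let G := st_graph I in
  VDisj (Graph (split_verts (verts G)) (split_arcs (verts G) (arcs G) (st_root I) q))
        (fun a => st_len I (merge_arc a)) (split_pairs q).

Definition embed (e : nat * seq nat) : seq nat :=
  copy e.1 (last e.1 e.2) :: [seq copy x x | x <- e.2].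

Lemma split_arcsP V A r q a :
  reflect (exists x y z z', [/\ (x, y) \in A, z \in copies V r q x,
             z' \in copies V r q y & a = (copy x z, copy y z')])
          (a \in split_arcs V A r q).
Proof.
apply: (iffP allpairsPdep).
  move=> [[x y] [zz [eA /allpairsP[[z z'] /= [zx zy ->]] ->]]].
  by exists x, y, z, z'.
move=> [x [y [z [z' [xyA zx zy ->]]]]]; exists (x, y), (z, z'); split=> //.
by apply/allpairsP; exists (z, z').
Qed.

(** The sources are off-diagonal copies, since a topological list has no loops, and the sinks are
    diagonal copies of distinct heads, so all ends differ. The copies usable at a vertex do not
    depend on the direction of the arc, which preserves symmetry in the undirected case. *)
Lemma split_instance_valid o I q :
  steiner_valid o I -> topological [:: st_root I] q ->
  (forall e, e \in q -> (e.1 \in verts (st_graph I)) && (e.2 \in verts (st_graph I))) ->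
  vdisj_valid o (split_instance I q).
Proof.
move=> [[[uV uA AV Asym] _] _ _ _ [wl _ nn]] tq qV.
set V := verts _ in uV AV qV *; set A := arcs _ in uA AV Asym nn wl *; set r := st_root I in tq *.
have cV x z : z \in copies V r q x -> z \in V by rewrite mem_filter => /andP[].
have splitA a : a \in split_arcs V A r q -> merge_arc a \in A.
  by case/split_arcsP=> x [y [z [z' [xyA _ _ ->]]]]; rewrite /merge_arc /= !copyK.
split; first split.
- by apply: allpairs_uniq => // -[x z] [x' z'] _ _ /copy_inj.
- apply: (@allpairs_uniq_dep _ (fun=> (nat * nat)%type)) => // [e _|].
    apply: allpairs_uniq; try exact: filter_uniq.
    by move=> [x z] [x' z'] _ _.
  move=> [[x y] [z z']] [[x1 y1] [z1 z1']] _ _ /=.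
  by move=> [/copy_inj[-> ->] /copy_inj[-> ->]].
- move=> _ /split_arcsP[x [y [z [z' [xyA zx zy ->]]]]] /=.
  have [/= xV yV xy] := AV _ xyA; split; rewrite ?allpairs_f ?(cV _ _ zx) ?(cV _ _ zy) //.
  by apply: contraNneq xy => /copy_inj[->].
- move=> oU _ /split_arcsP[x [y [z [z' [xyA zx zy ->]]]]] /=.
  by apply/split_arcsP; exists y, x, z', z; split=> //; apply: (Asym oU) xyA.
- by move=> oU a /splitA aA; apply: (wl oU) aA.
- by move=> a /splitA/nn[].
rewrite /split_pairs /= -!map_comp; split.
  have u2 : uniq [seq copy e.2 e.2 | e <- q].
    rewrite (map_comp (fun x => copy x x) snd) map_inj_uniq ?(topological_uniq tq) //.
    by move=> x y /copy_inj[].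
  have u1 : uniq [seq copy e.1 e.2 | e <- q].
    rewrite (map_comp (fun e => copy e.1 e.2) id) map_id map_inj_uniq.
      exact: map_uniq (topological_uniq tq).
    by move=> [x y] [x' y'] /copy_inj.
  rewrite cat_uniq u1 u2 andbT /=; apply/hasPn => _ /mapP[e eq ->] /=.
  apply/negP => /mapP[f fq /copy_inj[e1 e2]].
  by have := topological_loopless tq fq; rewrite -e1 -e2 eqxx.
move=> x; rewrite mem_cat => /orP[] /mapP[e eq ->] /=;
  by case/andP: (qV e eq) => e1 e2; apply: allpairs_f.
Qed.

Lemma uniq_flatten (mus : seq (seq nat)) :
  uniq (flatten mus) = all uniq mus && pairwise (fun mu nu => ~~ has (mem mu) nu) mus.
Proof.
elim: mus => //= mu mus IHmus; rewrite cat_uniq IHmus -!andbA; congr (_ && _).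
suff -> : ~~ has (mem mu) (flatten mus) = all (fun nu => ~~ has (mem mu) nu) mus.
  by rewrite andbCA.
by elim: mus {IHmus} => //= nu mus IHmus; rewrite has_cat negb_or IHmus.
Qed.

(** Separates the starting copies from the diagonal ones, which reduces disjointness of the embedded
    paths to distinctness of the skeleton arcs and of the vertices in [psys_verts]. *)
Lemma perm_embed P : perm_eq (flatten (map embed P))
  ([seq copy e.1 e.2 | e <- skeleton P] ++ [seq copy x x | x <- psys_verts P]).
Proof.
elim: P => //= e P IHP; rewrite perm_cons /psys_verts /= map_cat perm_sym.
by rewrite perm_catCA perm_cat2l perm_sym.
Qed.

Lemma copy_diag_inj : injective (fun x => copy x x).
Proof. by move=> x y /copy_inj[]. Qed.

Lemma embed_uniq_verts P : uniq (flatten (map embed P)) -> uniq (psys_verts P).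
Proof.
rewrite (perm_uniq (perm_embed P)) cat_uniq => /and3P[_ _].
by rewrite (map_inj_uniq copy_diag_inj).
Qed.

Lemma embed_uniq A r P : path_system A r P -> uniq (flatten (map embed P)).
Proof.
case=> rP _ tP; have uP : uniq (psys_verts P) by case/andP: rP.
rewrite (perm_uniq (perm_embed P)) cat_uniq.
rewrite (map_inj_uniq copy_diag_inj) uP andbT; apply/andP; split.
  rewrite map_inj_uniq; first exact: map_uniq (topological_uniq tP).
  by move=> [x y] [x' y'] /copy_inj.
apply/hasPn => _ /mapP[x xP ->]; apply/negP => /mapP[e eP /copy_inj[e1 e2]].
by have := topological_loopless tP eP; rewrite -e1 -e2 eqxx.
Qed.

Lemma merge_embed e : map merge_arc (path_arcs (embed e)) = path_arcs (e.1 :: e.2).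
Proof.
rewrite /path_arcs /embed /=; case: e => u p /=.
move: (last u p) => v; elim: p u v => //= x p IHp u v.
by rewrite -(IHp x x) /merge_arc /= !copyK.
Qed.

Lemma merge_embed_system P :
  map merge_arc (flatten (map path_arcs (map embed P))) = psys_arcs P.
Proof.
rewrite /psys_arcs map_flatten -!map_comp; congr flatten.
by apply: eq_map => e; apply: merge_embed.
Qed.

Lemma split_cost I q P :
  vdisj_cost (split_instance I q) (map embed P) = steiner_cost I (psys_arcs P).
Proof.
rewrite /steiner_cost -merge_embed_system big_map big_flatten /= big_map.
by rewrite /vdisj_cost.
Qed.

Lemma all2_maps (S T U : Type) (f : T -> U -> bool) (g : S -> T) (h : S -> U) s :
  all2 f (map g s) (map h s) = all (fun x => f (g x) (h x)) s.
Proof. by elim: s => //= x s ->. Qed.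

Lemma mem_all2 (S : eqType) (T : Type) (f : S -> T -> bool) s t x :
  all2 f s t -> x \in s -> exists2 y, f x y & List.In y t.
Proof.
elim: s t => // x0 s IHs [|y0 t] //= /andP[f0 ft].
rewrite inE => /predU1P[->|/(IHs _ ft)[y fy yt]]; first by exists y0; auto.
by exists y; auto.
Qed.

Section Split.
Variable I : steiner.
Let G := st_graph I.
Let r := st_root I.
Hypothesis wfA : forall e, e \in arcs G -> (e.1 \in verts G) && (e.2 \in verts G).

Lemma split_path q x z p :
  path (adj (arcs G)) x p -> z \in copies (verts G) r q x -> r \notin p ->
  path (adj (split_arcs (verts G) (arcs G) r q)) (copy x z) [seq copy y y | y <- p].
Proof.
elim: p x z => //= y p IHp x z /andP[xy yp] zx.
rewrite inE negb_or eq_sym => /andP[yr rp].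
have yy : y \in copies (verts G) r q y.
  by rewrite mem_filter eqxx yr /=; case/andP: (wfA xy).
rewrite IHp // andbT; apply/split_arcsP; by exists x, y, z, y.
Qed.

Lemma embed_feasible P :
  path_system (arcs G) r P ->
  vdisj_feasible (split_instance I (skeleton P)) (map embed P).
Proof.
move=> psP; have uE := embed_uniq psP.
move: (uE); rewrite uniq_flatten => /andP[/allP uE' pw]; split=> //.
rewrite /= /split_pairs -map_comp all2_maps; apply/allP => e eP.
have lP := psys_last psP eP; have pe := psys_path psP eP.
apply/and4P; split=> //=; last by apply: (uE' (embed e)); apply: map_f.
  apply: split_path => //; last first.
    case: psP => /andP[rP _] _ _; apply: contra rP; exact: mem_psys_verts eP.
  rewrite mem_filter; apply/andP; split; first by rewrite (map_f _ eP) orbT.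
  have /mapP[a aP ->] : last e.1 e.2 \in map snd (psys_arcs P).
    by rewrite psys_arcs_heads.
  by case/andP: (wfA (psys_arcs_sub psP aP)).
by rewrite -(last_map (fun x => copy x x)); case: (e.2) (psys_nonnil psP eP).
Qed.

(** Once the starting copies of skeleton arcs are barred, only diagonal copies of vertices other
    than the root can be entered. *)
Lemma split_path_embed q x z mu :
  path (adj (split_arcs (verts G) (arcs G) r q)) (copy x z) mu ->
  (forall y z', copy y z' \in mu -> (y, z') \notin q) ->
  exists p, [/\ mu = [seq copy y y | y <- p], path (adj (arcs G)) x p & r \notin p].
Proof.
elim: mu x z => [|n mu IHmu] x z /=; first by exists [::].
case/andP => /split_arcsP[x1 [y [z1 [z' [xyA _ zy]]]]] [/copy_inj[-> _] ->] h nq.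
move: zy; rewrite mem_filter (negbTE (nq y z' (mem_head _ _))) orbF.
case/andP => /andP[/eqP e yr] _.
have [|p [-> yp rp]] := IHmu y z' h.
  by move=> y2 z2 mu2; apply: nq; rewrite inE mu2 orbT.
by exists (y :: p); rewrite -e /= (_ : adj _ x1 y) // yp inE negb_or eq_sym yr rp.
Qed.

(** A starting copy is the first vertex of the solution path for its skeleton arc. By disjointness a
    path that enters it is that same path, which would then revisit its own first vertex. So
    [split_path_embed] applies to every path. *)
Lemma feasible_embed q mus :
  topological [:: r] q -> vdisj_feasible (split_instance I q) mus ->
  exists P, [/\ path_system (arcs G) r P, skeleton P = q & mus = map embed P].
Proof.
move=> tq [lk pw].
have um : all uniq mus.
  move: lk => /=; elim: mus (split_pairs q) {pw} => // mu mus IH [|pr prs] //= /andP[l /IH ->].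
  by rewrite andbT; case: mu l => // x mu /and4P[].
have ufl : uniq (flatten mus) by rewrite uniq_flatten um pw.
have heads e : e \in q -> exists2 mu, mu \in mus & ohead mu = Some (copy e.1 e.2).
  move=> eq; move: lk; rewrite /= => lk.
  have {lk} := mem_all2 lk (map_f _ eq); case=> -[|x mu] //= /and4P[/eqP-> _ _ _] imu.
  exists (copy e.1 e.2 :: mu) => //.
  by elim: mus imu {pw um ufl} => //= nu mus IH [->|/IH]; rewrite inE ?eqxx // => ->; rewrite orbT.
have share (mu nu : seq nat) x : mu \in mus -> nu \in mus -> x \in mu -> x \in nu -> mu = nu.
  elim: mus ufl {lk pw um heads} => //= mu0 mus IH; rewrite cat_uniq => /and3P[_ dj us].
  rewrite !inE => /predU1P[->|m1] /predU1P[->|m2] // x1 x2; last exact: IH.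
    by case/hasP: dj; exists x => //; apply/flattenP; exists nu.
  by case/hasP: dj; exists x => //; apply/flattenP; exists mu.
have emb e mu : e \in q -> mu \in mus ->
    links (vd_graph (split_instance I q)) (copy e.1 e.2, copy e.2 e.2) mu ->
    exists p, [/\ mu = embed (e.1, p), last e.1 p = e.2, ~~ nilp p,
                  path (adj (arcs G)) e.1 p & r \notin p].
  move=> eq mum; case: mu mum => // x mu mum /= /and4P[/eqP xe pmu /eqP lmu umu].
  rewrite xe in mum pmu lmu umu.
  have [|p [mup ep rp]] := split_path_embed pmu.
    move=> y z ymu; apply/negP => /heads[nu num nuh].
    have ynu : copy y z \in nu by case: nu nuh {num} => //= n nu [->]; rewrite mem_head.
    have e_nu := share _ _ (copy y z) mum num.
    rewrite inE ymu orbT in e_nu; rewrite -(e_nu isT ynu) in nuh.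
    case: nuh => nuh; move: umu; by rewrite nuh /= ymu.
  have pn : ~~ nilp p.
    apply: contraNN (topological_loopless tq eq) => /nilP p0.
    by move: lmu; rewrite mup p0 /= => /copy_inj[->].
  have lp : last e.1 p = e.2.
    apply: copy_diag_inj; rewrite /= -lmu mup.
    by case: p pn {mup ep rp} => //= y p _; rewrite (last_map (fun x => copy x x)).
  by exists p; rewrite /embed /= lp xe mup.
have [P [skP muP PP]] : exists P, [/\ skeleton P = q, mus = map embed P &
    forall e, e \in P -> [/\ ~~ nilp e.2, path (adj (arcs G)) e.1 e.2 & r \notin e.2]].
  have {}emb e mu : e \in q -> mu \in mus ->
      links (vd_graph (split_instance I q)) (copy e.1 e.2, copy e.2 e.2) mu ->
      exists p, [/\ mu = embed (e.1, p), last e.1 p = e.2, ~~ nilp p,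
                  path (adj (arcs G)) e.1 p & r \notin p] by exact: emb.
  move: lk emb; rewrite /=; move: (Graph _ _) => H lk emb {um ufl pw heads share tq}.
  elim: q mus lk emb => [|e q IHq] [|mu mus] //=; first by exists [::].
  case/andP=> l lk emb.
  have [p [mup lp pn ep rp]] := emb e mu (mem_head _ _) (mem_head _ _) l.
  have [|P [skP muP PP]] := IHq mus lk.
    by move=> f nu fq num; apply: emb; rewrite inE ?fq ?num orbT.
  exists ((e.1, p) :: P); split; rewrite /= ?lp ?skP ?muP ?mup -?surjective_pairing //.
  by move=> f; rewrite inE => /predU1P[->|/PP].
exists P; split=> //; split; last by rewrite skP.
  rewrite /= embed_uniq_verts -?muP // andbT.
  by apply/flattenP => -[_ /mapP[e eP ->] re]; case: (PP e eP) => _ _ /negP.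
by apply/allP => e /PP[-> ->].
Qed.

End Split.

(** * Correctness of the reduction to disjoint paths *)

Definition crosses (V : seq nat) (mus : seq (seq nat)) (a : arc) : bool :=
  has (fun mu => has (fun z => has (fun z' =>
    (copy a.1 z, copy a.2 z') \in path_arcs mu) V) V) mus.

(** The tree is read off a solution by testing, for each arc of the graph, all pairs of copies of
    its ends. No copy needs to be decoded, and each arc is listed once. *)
Definition merged_arcs (I : steiner) (mus : seq (seq nat)) : seq arc :=
  [seq a <- arcs (st_graph I) | crosses (verts (st_graph I)) mus a].

(** The count is compared with all capacities in [caps]. This suffices for every arc of a path;
    equality of the capacities makes it necessary as well. *)
Definition skeleton_ok (r : nat) (T : seq nat) (caps : seq nat) (q : seq arc) : bool :=
  [&& topological [:: r] q,
      all (fun t => t \in r :: map snd q) T &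
      all (fun e => all (fun c =>
        count (fun t => t \in descendants [:: e.2] q) T <= c) caps) q].

Lemma eq_mem_reach A B x y : A =i B -> reach A x y -> reach B x y.
Proof.
by move=> AB [p xp py]; exists p => //; rewrite -(eq_path (e := adj A)) // => u v; apply: AB.
Qed.

Lemma perm_tree_verts r A B : perm_eq A B -> tree_verts r A =i tree_verts r B.
Proof. by move=> AB v; rewrite !inE !mem_cat !(perm_mem (perm_map _ AB)). Qed.

Lemma perm_tree_from r A B : perm_eq A B -> tree_from r A -> tree_from r B.
Proof.
move=> AB [uA tA]; have m := perm_mem AB; split; first by rewrite -(perm_uniq AB).
move=> v; rewrite -(perm_tree_verts _ AB) => /tA[p [rp up]].
have e : adj A =2 adj B by move=> x y; apply: m.
exists p; split; first by rewrite -(eq_path e).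
by move=> p'; rewrite -(eq_path e); apply: up.
Qed.

Lemma eq_mem_subtree_terms T A B v :
  A =i B -> subtree_terms T A v = subtree_terms T B v.
Proof.
move=> AB; apply: eq_count => t; apply/asboolP/asboolP; apply: eq_mem_reach => //.
Qed.

Section Reduction.
Variables (o : orientation) (I : steiner).
Hypothesis validI : steiner_valid o I.
Let G := st_graph I.
Let r := st_root I.
Let T := st_terms I.
Let caps := map (st_cap I) (arcs G).

Lemma wf_arcs e : e \in arcs G -> (e.1 \in verts G) && (e.2 \in verts G).
Proof. by case: validI => [[[_ _ AV _] _] _ _ _ _] /AV[-> ->]. Qed.

Lemma merged_embed P : path_system (arcs G) r P ->
  perm_eq (merged_arcs I (map embed P)) (psys_arcs P).
Proof.
move=> psP; case: (validI) => [[[_ uA _ _] _] _ _ _ _].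
apply: uniq_perm; [exact: filter_uniq | exact: psys_arcs_uniq psP |].
move=> a; rewrite mem_filter; apply/andP/idP => [[/hasP[mu]]|aP].
  case/mapP=> e eP -> /hasP[z zV /hasP[z' zV' az]] aA.
  apply/psys_arcsP; exists e => //; rewrite -merge_embed; apply/mapP.
  by exists (copy a.1 z, copy a.2 z'); rewrite // /merge_arc /= !copyK -surjective_pairing.
split; last exact: psys_arcs_sub psP _ aP.
case/psys_arcsP: aP => e eP; rewrite -merge_embed => /mapP[b be ab].
have : path (adj (split_arcs (verts G) (arcs G) r (skeleton P)))
    (copy e.1 (last e.1 e.2)) [seq copy x x | x <- e.2].
  have [lk' _] := embed_feasible wf_arcs psP.
  move: lk'; rewrite /= /split_pairs -map_comp all2_maps => /allP/(_ _ eP).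
  by case/and4P.
rewrite path_subset => /allP/(_ _ be)/split_arcsP[x [y [z [z' [xyA zx zy bE]]]]].
apply/hasP; exists (embed e); first exact: map_f.
rewrite bE in ab be; rewrite ab /merge_arc /= !copyK.
apply/hasP; exists z; first by move: zx; rewrite mem_filter => /andP[].
apply/hasP; exists z'; first by move: zy; rewrite mem_filter => /andP[].
exact: be.
Qed.

(** A solution is an embedded path system, whose arcs form a tree. By [psys_descendants] the
    terminals below an arc descend from the end of its path, and [skeleton_ok] bounds their
    number. *)
Lemma split_sound q mus :
  skeleton_ok r T caps q -> vdisj_feasible (split_instance I q) mus ->
  steiner_feasible I (merged_arcs I mus) /\
  steiner_cost I (merged_arcs I mus) = vdisj_cost (split_instance I q) mus.
Proof.
case/and3P=> tq /allP Tq /allP cq fm.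
have [P [psP skP muP]] := feasible_embed tq fm.
have mP := merged_embed psP; rewrite muP split_cost; split; last first.
  by rewrite /steiner_cost (perm_big _ mP).
split.
- by move=> a; rewrite mem_filter => /andP[].
- by apply: perm_tree_from (psys_tree psP); rewrite perm_sym.
- move=> t tT; rewrite (perm_tree_verts _ mP) (psys_tree_verts psP).
  have := Tq t tT; rewrite !inE => /orP[->//|].
  by rewrite -skP => /(skeleton_heads_sub psP)->; rewrite orbT.
- move=> a; rewrite (perm_mem mP) => aP.
  rewrite (eq_mem_subtree_terms _ _ (perm_mem mP)).
  case/psys_arcsP: (aP) => e eP ae.
  have eq : (e.1, last e.1 e.2) \in q by rewrite -skP; apply: map_f.
  have aA := psys_arcs_sub psP aP.
  have /allP/(_ _ (map_f _ aA)) := cq _ eq.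
  apply: leq_trans; rewrite /subtree_terms -/T.
  (* Membership in [T] is recorded in the predicate: [psys_descendants] needs to know that the
     vertex reached belongs to the skeleton. *)
  have -> : count (fun t => `[< reach (psys_arcs P) a.2 t >]) T =
      count (fun t => `[< reach (psys_arcs P) a.2 t >] && (t \in T)) T.
    by apply: eq_in_count => t tT; rewrite tT andbT.
  apply: sub_count => t /andP[/asboolP at_ tT]; rewrite -skP.
  apply: (psys_descendants psP eP (path_arcs_heads ae) at_).
  by rewrite skP; apply: Tq.
Qed.

(** The path system is built inside [B]. Descent in its skeleton implies reachability in [B], so the
    counts are bounded by those of [B], and dropping the other arcs of [B] does not raise the cost
    since lengths are nonnegative. *)
Lemma split_complete B :
  uniform_cap I -> steiner_feasible I B ->
  exists q mus, [/\ size q <= 2 * size T,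
    all (fun e => (e.1 \in verts G) && (e.2 \in verts G)) q,
    skeleton_ok r T caps q, vdisj_feasible (split_instance I q) mus &
    (vdisj_cost (split_instance I q) mus <= steiner_cost I B)%R].
Proof.
move=> unif [BA tB TB capB]; case: (validI) => [_ _ [rV _] _ [_ _ nn]].
have rchT t : t \in T -> reach B r t.
  by case: tB => _ h /TB/h[p [[rp pt] _]]; exists p.
have [P [psB Tq szP]] := psys_exists rchT.
have psP : path_system (arcs G) r P.
  case: psB => uP /allP aP tP; split=> //; apply/allP => e /aP/andP[pe ->].
  rewrite andbT; apply: sub_path pe => x y; exact: BA.
have headP x : x \in psys_verts P -> exists2 a, a \in B & a.2 = x.
  by rewrite -psys_arcs_heads => /mapP[a aP ->]; exists a => //; apply: psys_arcs_sub psB _ aP.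
have vP x : x \in psys_verts P -> x \in verts G.
  by case/headP=> a /BA/wf_arcs/andP[_ a2] <-.
exists (skeleton P), (map embed P); split.
- by rewrite size_map.
- apply/allP => _ /mapP[e eP ->] /=; rewrite (vP _ (psys_last psB eP)) andbT.
  by case/orP: (psys_tails psB eP) => [/eqP->//|/(skeleton_heads_sub psB)/vP].
- case: (psB) => _ _ tP; apply/and3P; split=> //; first exact/allP.
  apply/allP => _ /mapP[e eP ->] /=; apply/allP => _ /mapP[a aA ->].
  have [b bB be] := headP _ (psys_last psB eP).
  (* Uniformity enters here: the bound known for the arc [b] of [B] into the end of the path is
     carried over to the capacity of an arbitrary arc [a]. *)
  rewrite (unif a b aA (BA _ bB)); apply: leq_trans (capB b bB).
  apply: sub_count => t td; apply/asboolP; rewrite be.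
  apply: (descendants_ind (R := reach B (last e.1 e.2))) td.
    by move=> x; rewrite inE => /eqP->; apply: reach_refl.
  move=> _ /mapP[f fP ->] /= ef; apply: reach_trans ef _.
  apply: path_reach (psys_path psB fP) _.
  exact: mem_last.
- exact: embed_feasible wf_arcs _ psP.
- rewrite split_cost /steiner_cost.
  have uP := psys_arcs_uniq psB; have sP := psys_arcs_sub psB; have [uB _] := tB.
  rewrite [leRHS](perm_big (psys_arcs P ++ [seq a <- B | a \notin psys_arcs P])) /=.
    rewrite big_cat /= lerDl big_seq sumr_ge0 // => a.
    by rewrite mem_filter => /andP[_ /BA/nn[]].
  apply: uniq_perm => //.
    rewrite cat_uniq uP filter_uniq // andbT; apply/hasPn => a.
    by rewrite mem_filter => /andP[].
  move=> a; rewrite mem_cat mem_filter.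
  by case: (boolP (a \in psys_arcs P)) => [/sP->|].
Qed.

End Reduction.

(** * Computing the reduction *)

Section PolyGraph.
Context {X : Type} `{encodable X}.
Variables (r x : X -> nat) (q : X -> seq (nat * nat)).
Hypotheses (pr : polytime r) (px : polytime x) (pq : polytime q).

Lemma poly_topological : polytime (fun a => topological [:: r a] (q a)).
Proof.
apply: (poly_ext (f := fun a => (foldl (fun (s : seq nat * bool) e =>
    (e.2 :: s.1, s.2 && (e.1 \in s.1) && ~~ (e.2 \in s.1))) ([:: r a], true) (q a)).2)).
  move=> a; rewrite -[topological _ _]andTb.
  elim: (q a) [:: r a] true => [|e s IHs] seen b /=; first by rewrite andbT.
  by rewrite IHs -!andbA.
apply: poly_snd.
apply: (poly_foldl (h := fun y => vsize (encode y))); first exact: pbound_size.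
- move=> a [seen b] e; rewrite !(vsize_pair, vsize_cons, vsize_encode_bool) /=.
  lia.
- by poly_tac.
- by poly_tac.
- by [].
Qed.

Lemma poly_descendants : polytime (fun a => descendants [:: x a] (q a)).
Proof.
rewrite /descendants.
apply: (poly_foldl (h := fun y => vsize (encode y))); first exact: pbound_size.
- move=> a s e; case: ifP => _; last exact: leq_addr.
  by rewrite !vsize_cons !vsize_pair /=; lia.
- by poly_tac.
- by poly_tac.
- by [].
Qed.

Lemma poly_path_arcs (mu : X -> seq nat) :
  polytime mu -> polytime (fun a => path_arcs (mu a)).
Proof.
(* The previous vertex is initialized to the dummy 0; [behead] removes the spurious first pair. *)
move=> pmu; apply: (poly_ext (f := fun a => behead (rev (foldl
    (fun (s : nat * seq (nat * nat)) y => (y, (s.1, y) :: s.2)) (0, [::]) (mu a)).2))).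
  move=> a; have aux c t s : rev (foldl
      (fun (s : nat * seq (nat * nat)) y => (y, (s.1, y) :: s.2)) (c, t) s).2 =
      rev t ++ zip (c :: s) s.
    elim: s c t => [|y s IHs] c t; first by rewrite cats0.
    by rewrite /= IHs rev_cons cat_rcons.
  by rewrite aux /path_arcs; case: (mu a).
apply: poly_behead; apply: poly_rev; apply: poly_snd.
apply: (poly_foldl (h := fun y => 2 * vsize (encode y))).
- by apply: pbound_mul; [apply: pbound_const | apply: pbound_size].
- move=> a [c b] y; rewrite !(vsize_pair, vsize_cons) /=; lia.
- by poly_tac.
- by poly_tac.
- by [].
Qed.

End PolyGraph.

(** * Enumeration of skeletons, typed queries and comparison of costs *)

Fixpoint candidates (p : nat) (V : seq nat) : seq (seq (nat * nat)) :=
  if p is p'.+1 then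
    [::] :: [seq e :: q | e <- [seq (u, v) | u <- V, v <- V], q <- candidates p' V]
  else [:: [::]].

Lemma mem_candidates p V q :
  (q \in candidates p V) = (size q <= p) && all (fun e => (e.1 \in V) && (e.2 \in V)) q.
Proof.
elim: p q => [|p IHp] [|e q] //=; rewrite inE /=.
have -> : (e :: q \in [seq e :: q | e <- [seq (u, v) | u <- V, v <- V],
                                    q <- candidates p V]) =
    ((e \in [seq (u, v) | u <- V, v <- V]) && (q \in candidates p V)).
  apply/allpairsP/andP => [[[e' q'] /= [e'V q'p [-> ->]]] //|[eV qp]].
  by exists (e, q).
rewrite IHp ltnS andbCA; congr (_ && (_ && _)).
apply/allpairsP/andP => [[[u v] /= [uV vV ->]] //|[e1 e2]].
by exists e; rewrite -surjective_pairing.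
Qed.

(* An arc with its length, as a fraction, and its capacity. *)
Definition entry : Type := (nat * nat) * ((nat * nat) * nat).

(* The length of [e] times the product of all denominators, by which costs are *)
(* compared without arithmetic on fractions.                                  *)
Definition weight (E : seq entry) (e : entry) : nat :=
  e.2.1.1 * foldl (fun s e' => if e'.1 == e.1 then s else s * e'.2.1.2) 1 E.

Definition total_weight (E F : seq entry) : nat :=
  foldl (fun s e => s + weight E e) 0 F.

(* Options are lists with at most one element, which have the same codes. *)
Definition lightest (E : seq entry) (Fs : seq (seq entry)) : seq (seq entry) :=
  foldl (fun b F =>
    if nilp b || (total_weight E F < total_weight E (head [::] b)) then [:: F] else b)
  [::] Fs.

(** The program is built by recursion on [p], with one more nesting of loops each time. The degree
    of its bound grows with [p], so the number of terminals has to be fixed. *)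
Lemma poly_candidates p : polytime (candidates p).
Proof. by elim: p => [|p IHp]; rewrite /candidates -/candidates; poly_tac. Qed.

Section PolyReduction.
Context {X : Type} `{encodable X}.

Lemma poly_skeleton_ok (r : X -> nat) (T caps : X -> seq nat) (q : X -> seq (nat * nat)) :
  polytime r -> polytime T -> polytime caps -> polytime q ->
  polytime (fun a => skeleton_ok (r a) (T a) (caps a) (q a)).
Proof.
move=> pr pT pc pq; rewrite /skeleton_ok.
do !apply: poly_andb; poly_tac; first exact: poly_topological.
by apply: poly_descendants; poly_tac.
Qed.

Lemma poly_crosses (V : X -> seq nat) (mus : X -> seq (seq nat)) (e : X -> nat * nat) :
  polytime V -> polytime mus -> polytime e ->
  polytime (fun a => crosses (V a) (mus a) (e a)).
Proof.
by move=> pV pmus pe; rewrite /crosses /copy; poly_tac; apply: poly_path_arcs; poly_tac.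
Qed.

Lemma poly_weight (E : X -> seq entry) (e : X -> entry) :
  polytime E -> polytime e -> polytime (fun a => weight (E a) (e a)).
Proof.
move=> pE pe; rewrite /weight; poly_tac.
apply: (poly_foldl (h := fun y => vsize (encode y))); first exact: pbound_size.
- move=> a s f; case: ifP => _; first exact: leq_addr.
  apply: leq_trans (vsize_mul _ _) _; rewrite leq_add2l !vsize_pair /=; lia.
- by poly_tac.
- by poly_tac.
- by [].
Qed.

End PolyReduction.

Lemma poly_total_weight (X : Type) `{encodable X} (E F : X -> seq entry) :
  polytime E -> polytime F -> polytime (fun a => total_weight (E a) (F a)).
Proof.
move=> pE pF; rewrite /total_weight.
have pw : polytime (fun y : entry * X => weight (E y.2) y.1).
  by apply: poly_weight; poly_tac.
apply: (poly_foldl (h := fun y => vsize (encode (weight (E y.2) y.1)))).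
- exact: poly_size pw.
- by move=> a s f; apply: vsize_add.
- apply: poly_addn; poly_tac.
  by apply: (poly_comp pw); poly_tac.
- by poly_tac.
- by [].
Qed.

Lemma poly_lightest (X : Type) `{encodable X} (E : X -> seq entry) (Fs : X -> seq (seq entry)) :
  polytime E -> polytime Fs -> polytime (fun a => lightest (E a) (Fs a)).
Proof.
move=> pE pF; rewrite /lightest.
apply: (poly_foldl (h := fun y => vsize (encode [:: y.1]))).
- exact: (poly_size (f := fun y => [:: y.1]) (poly_cons (poly_fst poly_id) (poly_const _))).
- by move=> a s F; case: ifP => _; [apply: leq_addl | apply: leq_addr].
- poly_tac; first by apply: poly_total_weight; poly_tac.
  by apply: poly_total_weight; poly_tac.
- by poly_tac.
- by [].
Qed.

Definition fraction (x : rat) : nat * nat := (`|numq x|%N, `|denq x|%N).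

Definition entry_of (I : steiner) (e : arc) : entry :=
  (e, (fraction (st_len I e), st_cap I e)).

Definition entries (I : steiner) : seq entry := map (entry_of I) (arcs (st_graph I)).

Definition input : Type := (seq nat * seq entry) * (seq nat * nat).

Definition input_of (I : steiner) : input :=
  ((verts (st_graph I), entries I), (st_terms I, st_root I)).

Definition query : Type := (seq nat * seq ((nat * nat) * (nat * nat))) * seq (nat * nat).

(** Computes the code of [split_instance], with each length carried over from the arc being copied
    instead of recovered through [original]. *)
Definition query_of (x : input) (q : seq (nat * nat)) : query :=
  let cs := copies x.1.1 x.2.2 q in
  ((split_verts x.1.1,
    [seq ((copy e.1.1 zz.1, copy e.1.2 zz.2), e.2.1) | e <- x.1.2,
       zz <- [seq (z, z') | z <- cs e.1.1, z' <- cs e.1.2]]),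
   split_pairs q).

Definition queries (p : nat) (x : input) : seq query :=
  [seq query_of x q | q <- [seq q <- candidates p x.1.1 |
     skeleton_ok x.2.2 x.2.1 [seq e.2.2 | e <- x.1.2] q]].

(** Each answer is an option coded as a list, so that unsolvable queries contribute nothing. *)
Definition solutions (x : input) (ans : seq (seq (seq (seq nat)))) : seq (seq entry) :=
  flatten [seq [seq [seq e <- x.1.2 | crosses x.1.1 mus e.1] | mus <- s] | s <- ans].

Definition best_tree (y : input * seq (seq (seq (seq nat)))) : seq (seq (nat * nat)) :=
  [seq map fst F | F <- lightest y.1.1.2 (solutions y.1 y.2)].

Lemma poly_queries p : polytime (queries p).
Proof.
have pc := poly_candidates p.
rewrite /queries /query_of /split_verts /split_pairs /copies /copy; poly_tac.
by apply: poly_skeleton_ok; poly_tac.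
Qed.

Lemma poly_best_tree : polytime best_tree.
Proof.
rewrite /best_tree; poly_tac; apply: poly_lightest; rewrite /solutions; poly_tac.
by apply: poly_crosses; poly_tac.
Qed.

Lemma code_seq_map (S T : Type) (enc : T -> value) (f : S -> T) s :
  code_seq enc (map f s) = code_seq (fun x => enc (f x)) s.
Proof. by elim: s => //= x s ->. Qed.

Lemma code_seq_inj (T : Type) (enc : T -> value) :
  injective enc -> injective (code_seq enc).
Proof. by move=> ei; elim=> [|x s IHs] [|y t] //= [/ei-> /IHs->]. Qed.

Lemma encode_input I : steiner_code I = encode (input_of I).
Proof. by rewrite /encode /= /encodable_pair /encode /encodable_seq code_seq_map. Qed.

Lemma encode_query I q : encode (query_of (input_of I) q) = vdisj_code (split_instance I q).
Proof.
have -> : query_of (input_of I) q =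
    ((verts (vd_graph (split_instance I q)),
     [seq (a, fraction (vd_len (split_instance I q) a)) |
        a <- arcs (vd_graph (split_instance I q))]), split_pairs q).
  rewrite /query_of /=; congr (_, _, _).
  rewrite /split_arcs map_flatten -!map_comp; congr flatten.
  apply: eq_map => e; rewrite /= -map_comp; apply: eq_map => zz /=.
  by rewrite /merge_arc /= !copyK -surjective_pairing.
by rewrite /encode /= /encodable_pair /encode /encodable_seq code_seq_map.
Qed.

Lemma lightestP E Fs :
  (Fs = [::] /\ lightest E Fs = [::]) \/
  exists2 F, F \in Fs & lightest E Fs = [:: F] /\
    forall F', F' \in Fs -> total_weight E F <= total_weight E F'.
Proof.
elim/last_ind: Fs => [|Fs F IH]; [by left | right].
rewrite /lightest foldl_rcons -/(lightest E Fs).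
case: IH => [[-> ->]|[F0 F0s [-> h]]] /=.
  by exists F; rewrite ?mem_head //; split=> // F'; rewrite inE => /eqP->.
case: ltnP => FF0.
  exists F; rewrite ?mem_rcons ?mem_head //; split=> // F'.
  rewrite mem_rcons inE => /predU1P[->//|/h]; exact: leq_trans (ltnW FF0).
exists F0; first by rewrite mem_rcons inE F0s orbT.
by split=> // F'; rewrite mem_rcons inE => /predU1P[->//|/h].
Qed.

Lemma total_weightE E F : total_weight E F = \sum_(e <- F) weight E e.
Proof.
suff h n : foldl (fun s e => s + weight E e) n F = n + \sum_(e <- F) weight E e by exact: h.
elim: F n => [|e F IHF] n /=; first by rewrite big_nil addn0.
by rewrite IHF big_cons addnA.
Qed.

Lemma weightE I a : weight (entries I) (entry_of I a) =
  `|numq (st_len I a)| *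
  \prod_(b <- arcs (st_graph I) | b != a) `|denq (st_len I b)|.
Proof.
rewrite /weight /=; congr (_ * _); rewrite /entries.
suff h n A : foldl (fun s e' => if e'.1 == a then s else s * e'.2.1.2) n
    (map (entry_of I) A) = n * \prod_(b <- A | b != a) `|denq (st_len I b)|.
  by rewrite h mul1n.
elim: A n => [|b A IHA] n /=; first by rewrite big_nil muln1.
by rewrite IHA big_cons /=; case: eqP => //= _; rewrite mulnA.
Qed.

(** Multiplied by the product of all denominators, a length becomes its numerator times the other
    denominators. This common positive factor preserves the order of costs. *)
Lemma total_weight_cost I A :
  uniq (arcs (st_graph I)) -> (forall e, e \in arcs (st_graph I) -> (0 <= st_len I e)%R) ->
  {subset A <= arcs (st_graph I)} ->
  ((total_weight (entries I) (map (entry_of I) A))%:R =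
   (\prod_(b <- arcs (st_graph I)) `|denq (st_len I b)|)%N%:R * steiner_cost I A)%R.
Proof.
move=> uA nn AG; rewrite total_weightE big_map natr_sum /steiner_cost mulr_sumr.
apply: eq_big_seq => a /AG aA.
rewrite weightE (bigD1_seq a aA uA) /= !natrM mulrAC; congr (_ * _)%R.
rewrite -{3}(divq_num_den (st_len I a)) mulrCA !natr_absz normr_denq.
by rewrite (ger0_norm (_ : 0 <= numq _)%R) ?numq_ge0 ?nn // divff ?mulr1 // intr_eq0 denq_neq0.
Qed.

(** The size of a coded list is a sum over its elements, hence invariant under permutation; the
    elements of [s] are removed from [t] one at a time. *)
Lemma vsize_uniq_sub (s t : seq nat) :
  uniq s -> {subset s <= t} -> vsize (encode s) <= vsize (encode t).
Proof.
have perm (u v : seq nat) : perm_eq u v -> vsize (encode u) = vsize (encode v).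
  have E w : vsize (encode w) = (\sum_(x <- w) (vsize (VNat x)).+1).+1.
    elim: w => [|x w IHw]; first by rewrite big_nil /= trunc_log0.
    by rewrite vsize_cons big_cons IHw !addSn addnS.
  by move=> uv; rewrite !E (perm_big _ uv).
elim: s t => [|x s IHs] t /=; first by rewrite vsize_gt0.
case/andP=> xs us st; have xt : x \in t by apply: st; rewrite mem_head.
rewrite (perm _ _ (perm_to_rem xt)) !vsize_cons ltnS leq_add2l IHs // => y ys.
have := st y; rewrite (perm_mem (perm_to_rem xt)) !inE ys orbT => /(_ isT).
by case: eqP => // yx; rewrite -yx ys in xs.
Qed.

(** A solution has one path per pair, and each path repeats no vertex, so its code is no larger than
    that of the vertex list. *)
Lemma feasible_vsize o J mus :
  vdisj_valid o J -> vdisj_feasible J mus ->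
  vsize (encode mus) <= 2 * vsize (vdisj_code J) ^ 2.
Proof.
move=> [[_ _ AV _] _ _ [_ sV]] [lk _].
set N := vsize (vdisj_code J).
have vN : vsize (encode (verts (vd_graph J))) + (size (vd_pairs J)).+1 <= N.
  have sz : size (vd_pairs J) < vsize (encode (vd_pairs J)) by exact: size_encode.
  rewrite /N; have -> : vdisj_code J = VPair (VPair (encode (verts (vd_graph J)))
      (vsnd (code_graph (vd_graph J) (fun e => code_rat (vd_len J e)))))
      (encode (vd_pairs J)) by [].
  move: sz => /=; lia.
have muN (p : nat * nat) mu : p.1 \in verts (vd_graph J) -> links (vd_graph J) p mu ->
    vsize (encode mu) <= vsize (encode (verts (vd_graph J))).
  move=> p1; case: mu => // x mu /and4P[/eqP xp pmu _ umu].
  apply: vsize_uniq_sub => // y; rewrite inE => /predU1P[->|ymu]; first by rewrite xp.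
  have /mapP[a aA ->] : y \in map snd (path_arcs (x :: mu)).
    by rewrite -[map snd _]/(unzip2 _) unzip2_zip //= leqW.
  by move: pmu; rewrite path_subset => /allP/(_ _ aA)/AV[].
have musN : vsize (encode mus) <=
    size (vd_pairs J) * (vsize (encode (verts (vd_graph J)))).+1 + 1.
  have pV p : p \in vd_pairs J -> p.1 \in verts (vd_graph J).
    by move=> pJ; apply: sV; rewrite mem_cat map_f.
  elim: (vd_pairs J) mus lk pV => [|p ps IH] [|mu mus] // /andP[l lk] pV.
  have := IH mus lk (fun p' p'ps => pV p' (mem_behead (s := p :: ps) p'ps)).
  have := muN p mu (pV p (mem_head _ _)) l.
  by rewrite vsize_cons [size (_ :: _)]/= mulSn; lia.
apply: leq_trans musN _; rewrite -mulnn; nia.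
Qed.

Lemma mem_queries p I b :
  reflect (exists q, [/\ size q <= p,
      all (fun e => (e.1 \in verts (st_graph I)) && (e.2 \in verts (st_graph I))) q,
      skeleton_ok (st_root I) (st_terms I) (map (st_cap I) (arcs (st_graph I))) q &
      b = query_of (input_of I) q])
    (b \in queries p (input_of I)).
Proof.
have capsE : [seq e.2.2 | e <- entries I] = map (st_cap I) (arcs (st_graph I)).
  by rewrite -map_comp.
apply: (iffP mapP) => [[q]|[q [sq vq okq ->]]].
  rewrite mem_filter mem_candidates /= capsE => /and3P[okq sq vq] ->.
  by exists q.
by exists q => //; rewrite mem_filter mem_candidates /= capsE okq sq vq.
Qed.

Lemma skeleton_ok_topological r T caps q : skeleton_ok r T caps q -> topological [:: r] q.
Proof. by case/and3P. Qed.

Lemma split_valid o I q T caps :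
  steiner_valid o I -> skeleton_ok (st_root I) T caps q ->
  all (fun e => (e.1 \in verts (st_graph I)) && (e.2 \in verts (st_graph I))) q ->
  vdisj_valid o (split_instance I q).
Proof.
by move=> vI /skeleton_ok_topological tq /allP vq; apply: split_instance_valid vI tq vq.
Qed.

Lemma solutionsP I (ans : seq (seq (seq (seq nat)))) F :
  reflect (exists s mus, [/\ s \in ans, mus \in s & F = map (entry_of I) (merged_arcs I mus)])
    (F \in solutions (input_of I) ans).
Proof.
have FE mus : [seq e <- entries I | crosses (verts (st_graph I)) mus e.1] =
    map (entry_of I) (merged_arcs I mus) by rewrite filter_map.
apply: (iffP flatten_mapP) => [[s sa /mapP[mus ms]]|[s [mus [sa ms]]]] /=.
  by rewrite FE => ->; exists s, mus.
by rewrite -FE => ->; exists s => //; apply: map_f.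
Qed.

(** * The optimization and the decision reductions *)

Lemma ml_reduction o K :
  poly_reducible
    (@restrict (ML_CAP_STEINER_TREE o)
       (fun I : steiner => size (st_terms I) = K /\ uniform_cap I))
    (@restrict (ML_VDISJ_PATH o)
       (fun J : vdisj => size (vd_pairs J) <= 2 * K)).
Proof.
set P := restrict _; set Q := restrict _.
apply: (@poly_reducible_by_queries P Q input query (seq (seq (seq nat))) (seq (seq (nat * nat)))
  _ _ _ _ input_of (queries (2 * K)) best_tree [::]).
- exact: encode_input.
- exact: poly_queries.
- exact: poly_best_tree.
- move=> I /= [vI [sT uI]] b /mem_queries[q [sq vq okq ->]].
  exists (split_instance I q); last exact: encode_query.
  by split; [apply: split_valid vI okq vq | rewrite size_map].
(* [feasible_vsize] gives the factor 2, and the option wrapper adds 2 to the size. *)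
- exists 4, 2 => J /= [vJ _] y [[mus [fm _ ->]]|[_ ->]]; last first.
    by exists [::]; rewrite // muln_gt0 expn_gt0 vsize_gt0.
  exists [:: mus] => //; rewrite /= -[code_seq _ _]/(encode mus).
  have := feasible_vsize vJ fm; rewrite trunc_log0.
  have := vsize_gt0 (vdisj_code J); set N := vsize _; set S := vsize _ => N0.
  rewrite -mulnn; nia.
move=> I [vI [sT uI]] g gP /=.
have {}gP q : size q <= 2 * K ->
    all (fun e => (e.1 \in verts (st_graph I)) && (e.2 \in verts (st_graph I))) q ->
    skeleton_ok (st_root I) (st_terms I) (map (st_cap I) (arcs (st_graph I))) q ->
    optimal_answer (vdisj_feasible (split_instance I q)) (vdisj_cost (split_instance I q))
      (code_seq (code_seq VNat)) (encode (g (query_of (input_of I) q))).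
  move=> sq vq okq; apply: (gP _ _ (split_instance I q)).
  - by apply/mem_queries; exists q.
  - by split; [apply: split_valid vI okq vq | rewrite size_map].
  - by rewrite encode_query.
set qs := map g _.
pose Fs := solutions (input_of I) qs.
have enc_inj : injective (@encode (seq (seq (seq nat))) _).
  by do 3!apply: code_seq_inj; move=> x y [].
have FsP F : F \in Fs -> exists q mus, [/\
    skeleton_ok (st_root I) (st_terms I) (map (st_cap I) (arcs (st_graph I))) q,
    vdisj_feasible (split_instance I q) mus & F = map (entry_of I) (merged_arcs I mus)].
  case/solutionsP => s [mus [/mapP[b /mem_queries[q [sq vq okq ->]] ->] ms ->]].
  exists q, mus; split=> //.
  case: (gP q sq vq okq) => [[mus' [fm' _ e]]|[_ e]].
    have /enc_inj e' : encode (g (query_of (input_of I) q)) = encode [:: mus'] by [].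
    by move: ms; rewrite e' inE => /eqP->.
  have /enc_inj e' : encode (g (query_of (input_of I) q)) =
    encode ([::] : seq (seq (seq nat))) by [].
  by move: ms; rewrite e'.
have Fs_complete B : steiner_feasible I B -> exists mus, [/\
    map (entry_of I) (merged_arcs I mus) \in Fs,
    steiner_feasible I (merged_arcs I mus) &
    (steiner_cost I (merged_arcs I mus) <= steiner_cost I B)%R].
  move=> fB; have [q [mus [sq vq okq fm cm]]] := split_complete vI uI fB.
  rewrite sT in sq.
  (* The solution obtained from [B] only shows that this query is solvable; the tree is merged from
     the optimal answer of the oracle, which costs no more. *)
  case: (gP q sq vq okq) => [[mus' [fm' opt e]]|[nf _]]; last by case: (nf mus).
  have /enc_inj e' : encode (g (query_of (input_of I) q)) = encode [:: mus'] by [].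
  have [fT cT] := split_sound vI okq fm'.
  exists mus'; split=> //; last by rewrite cT; apply: le_trans (opt _ fm) cm.
  apply/solutionsP; exists [:: mus'], mus'; split=> //; rewrite ?mem_head // -e'.
  by apply: map_f; apply/mem_queries; exists q.
have weight_le mus mus' : (total_weight (entries I) (map (entry_of I) (merged_arcs I mus)) <=
      total_weight (entries I) (map (entry_of I) (merged_arcs I mus')))%N ->
    (steiner_cost I (merged_arcs I mus) <= steiner_cost I (merged_arcs I mus'))%R.
  case: (vI) => [[[_ uA _ _] _] _ _ _ [_ _ nn]].
  have sub m : {subset merged_arcs I m <= arcs (st_graph I)}.
    by move=> a; rewrite mem_filter => /andP[].
  have nn' e : e \in arcs (st_graph I) -> (0 <= st_len I e)%R by move=> /nn[].
  rewrite -(ler_nat rat) !total_weight_cost // ler_pM2l //.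
  by rewrite ltr0n prodn_cond_gt0 // => b _; rewrite absz_gt0 denq_neq0.
have [[Fs0 l0]|[F FFs [lF minF]]] := lightestP (entries I) Fs.
  right; split; last by rewrite /best_tree /= -/Fs l0.
  by move=> B /Fs_complete[mus [+ _ _]]; rewrite Fs0.
left; have [q [mus [okq fm FE]]] := FsP F FFs.
have [fT cT] := split_sound vI okq fm.
exists (merged_arcs I mus); split=> //.
  move=> B /Fs_complete[mus' [F' _ c']]; apply: le_trans c'.
  by apply: weight_le; rewrite -FE; apply: minF.
rewrite /best_tree /= -/Fs lF /= FE -map_comp (eq_map (g := id)) // map_id.
by [].
Qed.

(** The queries are those of the optimization version. Their arcs inherit length 0, and the answers
    are combined by disjunction. *)
Lemma decision_reduction o K :
  poly_reducible
    (@restrict (CAP_STEINER_TREE o)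
       (fun I : steiner => size (st_terms I) = K /\ uniform_cap I))
    (@restrict (VDISJ_PATH o)
       (fun J : vdisj => size (vd_pairs J) <= 2 * K)).
Proof.
set P := restrict _; set Q := restrict _.
apply: (@poly_reducible_by_queries P Q input query bool bool _ _ _ _ input_of
  (queries (2 * K)) (fun y : input * seq bool => has (fun b => b) y.2) false).
- exact: encode_input.
- exact: poly_queries.
- by poly_tac.
- move=> I /= [[vI l0] [sT uI]] b /mem_queries[q [sq vq okq ->]].
  exists (split_instance I q); last exact: encode_query.
  split; last by rewrite size_map.
  split; first exact: split_valid vI okq vq.
  move=> _ /split_arcsP[x [y [z [z' [xyA _ _ ->]]]]] /=.
  by rewrite /merge_arc /= !copyK l0.
- exists 1, 0 => J /= _ y ->; exists `[< exists s, vdisj_feasible J s >] => //.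
  by rewrite vsize_bool.
move=> I [[vI l0] [sT uI]] g gP /=.
have {}gP q : size q <= 2 * K ->
    all (fun e => (e.1 \in verts (st_graph I)) && (e.2 \in verts (st_graph I))) q ->
    skeleton_ok (st_root I) (st_terms I) (map (st_cap I) (arcs (st_graph I))) q ->
    g (query_of (input_of I) q) = `[< exists s, vdisj_feasible (split_instance I q) s >].
  move=> sq vq okq.
  have : correct (p := @restrict (VDISJ_PATH o) (fun J : vdisj => size (vd_pairs J) <= 2 * K))
      (split_instance I q) (encode (g (query_of (input_of I) q))).
    apply: gP; first by apply/mem_queries; exists q.
      split; last by rewrite size_map.
      split; first exact: split_valid vI okq vq.
      move=> _ /split_arcsP[x [y [z [z' [xyA _ _ ->]]]]] /=.
      by rewrite /merge_arc /= !copyK l0.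
    by rewrite encode_query.
  by case; case: (g _); case: `[< _ >].
rewrite /decision_answer; congr vbool; apply/hasP/asboolP.
  move=> [_ /mapP[b /mem_queries[q [sq vq okq ->]] ->]].
  rewrite gP // => /asboolP[mus fm].
  by have [fT _] := split_sound vI okq fm; exists (merged_arcs I mus).
move=> [B /(split_complete vI uI)[q [mus [sq vq okq fm _]]]].
exists true => //; rewrite sT in sq.
have <- : g (query_of (input_of I) q) = true.
  by rewrite gP //; apply/asboolP; exists mus.
by apply: map_f; apply/mem_queries; exists q.
Qed.

Theorem theorem4p6 (K : nat) (hK : 0 < K) :
  exists p : nat, forall o : orientation,
    poly_reducible
      (@restrict (ML_CAP_STEINER_TREE o)
         (fun I : steiner => size (st_terms I) = K /\ uniform_cap I))
      (@restrict (ML_VDISJ_PATH o)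
         (fun J : vdisj => size (vd_pairs J) <= p))
    /\
    poly_reducible
      (@restrict (CAP_STEINER_TREE o)
         (fun I : steiner => size (st_terms I) = K /\ uniform_cap I))
      (@restrict (VDISJ_PATH o)
         (fun J : vdisj => size (vd_pairs J) <= p)).
Proof.
(* One source-sink pair per skeleton arc, whatever the orientation. *)
by exists (2 * K) => o; split; [apply: ml_reduction | apply: decision_reduction].
Qed.
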